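(* Let $\mathcal{X}_1,\mathcal{X}_2,\ldots$ be random variables corresponding to cyclotomic generating functions (each with positive variance, so that the standardizations are defined). Then the sequence of standardized random variables $\mathcal{X}_1^*,\mathcal{X}_2^*,\ldots$ converges in distribution if and only if for every $d\in\mathbb{Z}_{\geq1}$ the limit $\mu_d:=\lim_{N\to\infty}\mu_d^{\mathcal{X}_N^*}$ exists and is finite. In that case $\mathcal{X}_N^*\Rightarrow\mathcal{X}$ where $\mu_d=\mu_d^{\mathcal{X}}$ is the $d$th moment of $\mathcal{X}$ for all $d$, $\mathcal{X}$ is determined by its moments, and the moment generating function of $\mathcal{X}$ is entire.
   Context: A cyclotomic generating function (CGF) is a nonzero polynomial $f(q)=\sum_k c_kq^k$ with nonnegative integer coefficients all of whose complex roots are roots of unity or $0$; its corresponding random variable $\mathcal{X}$ satisfies $P(\mathcal{X}=k)=c_k/f(1)$, i.e. $\mathbb{E}[q^{\mathcal{X}}]=f(q)/f(1)$. For a random variable $\mathcal{X}$ with mean $\mu$ and variance $\sigma^2>0$, $\mathcal{X}^*=(\mathcal{X}-\mu)/\sigma$; $\mu_d^{\mathcal{Y}}=\mathbb{E}[\mathcal{Y}^d]$ denotes the $d$th moment. $\Rightarrow$ denotes convergence in distribution. *)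

(* Defs.v *)
From HB Require Import structures.
From mathcomp Require Import all_boot all_order all_algebra.
From mathcomp Require Import complex.
From mathcomp Require Import all_classical all_reals all_analysis.
From mathcomp Require Import measurable_realfun.

Set Implicit Arguments.
Unset Strict Implicit.
Unset Printing Implicit Defensive.

Import Order.TTheory GRing.Theory Num.Theory.
Import numFieldNormedType.Exports.

Local Open Scope classical_set_scope.
Local Open Scope ring_scope.

Definition is_root_of_unity (F : fieldType) (z : F) : Prop :=
  exists2 n : nat, (0 < n)%N & n.-unity_root z.

Definition is_CGF (R : realType) (f : {poly int}) : Prop :=
  [/\ f != 0, (forall k : nat, 0 <= f`_k) &
      forall z : R[i], root (map_poly (intr : int -> R[i]) f) z ->
        is_root_of_unity z \/ z = 0].

(* A nonzero [f] with nonnegative coefficients has [f.[1] > 0] and the masses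
   below add up to 1, so they fix the law of [X]. *)
Definition corresponds_to d (T : measurableType d) (R : realType)
    (P : probability T R) (X : {RV P >-> R}) (f : {poly int}) : Prop :=
  forall k : nat,
    P (X @^-1` [set k%:R]) = ((f`_k)%:~R / (f.[1])%:~R)%:E.

Section standardization.
Context d (T : measurableType d) (R : realType) (P : probability T R).
Variable X : {RV P >-> R}.

Definition standardize_fun (w : T) : R :=
  (X w - fine 'E_P[X]%E) / Num.sqrt (fine 'V_P[X]%E).

Lemma measurable_standardize : measurable_fun setT standardize_fun.
Proof. by apply: measurable_funM => //; apply: measurable_funB. Qed.

HB.instance Definition _ :=
  isMeasurableFun.Build _ _ _ _ standardize_fun measurable_standardize.

Definition standardize : {RV P >-> R} := standardize_fun.

End standardization.

Definition moment d (T : measurableType d) (R : realType)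
    (P : probability T R) (X : T -> R) (k : nat) : \bar R :=
  'E_P[fun w => (X w ^+ k)%R]%E.

(* In [\bar R] the expectation of a non-integrable function is an unspecified
   value, hence the separate predicate. *)
Definition finite_moment d (T : measurableType d) (R : realType)
    (P : probability T R) (X : T -> R) (k : nat) : Prop :=
  P.-integrable setT (fun w => (X w ^+ k)%:E).

(* The variables may live on different probability spaces. *)
Definition cvg_in_distribution (R : realType)
    (d : nat -> measure_display) (T : forall N, measurableType (d N))
    (P : forall N, probability (T N) R) (X : forall N, {RV (P N) >-> R})
    d' (T' : measurableType d') (P' : probability T' R) (Y : {RV P' >-> R})
    : Prop :=
  forall x : R, {for x, continuous (cdf Y)} ->
    cdf (X N) x @[N --> \oo] --> cdf Y x.

Definition is_cvg_in_distribution (R : realType)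
    (d : nat -> measure_display) (T : forall N, measurableType (d N))
    (P : forall N, probability (T N) R) (X : forall N, {RV (P N) >-> R})
    : Prop :=
  exists (d' : measure_display) (T' : measurableType d')
    (P' : probability T' R) (Y : {RV P' >-> R}), cvg_in_distribution X Y.

Definition determined_by_moments d (T : measurableType d) (R : realType)
    (P : probability T R) (X : {RV P >-> R}) : Prop :=
  (forall k, finite_moment P X k) /\
  forall d' (T' : measurableType d') (P' : probability T' R)
      (Y : {RV P' >-> R}),
    (forall k, finite_moment P' Y k /\ moment P' Y k = moment P X k) ->
    forall A : set R, measurable A -> distribution P' Y A = distribution P X A.

Section complex_mgf.
Context d (T : measurableType d) (R : realType) (P : probability T R).

(* Unqualified [Re] and [Im] denote the real and imaginary parts of an abstract
   [numClosedFieldType], with values in that same type; the coordinates in [R]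
   are [complex.Re] and [complex.Im]. *)
Definition cexp (z : R[i]) : R[i] :=
  Complex (expR (complex.Re z) * cos (complex.Im z))
          (expR (complex.Re z) * sin (complex.Im z)).

Definition cintegrable (Z : T -> R[i]) : Prop :=
  P.-integrable setT (fun w => (complex.Re (Z w))%:E) /\
  P.-integrable setT (fun w => (complex.Im (Z w))%:E).

Definition cexpectation (Z : T -> R[i]) : R[i] :=
  Complex (fine 'E_P[fun w => complex.Re (Z w)]%E)
          (fine 'E_P[fun w => complex.Im (Z w)]%E).

(* z |-> E[exp (z X)] for a complex argument z. *)
Definition cmgf (X : T -> R) (z : R[i]) : R[i] :=
  cexpectation (fun w => cexp (z * (X w)%:C%C)).

Lemma cmgf_real (X : T -> R) (t : R) :
  cmgf X t%:C%C = (fine (mmt_gen_fun P X t))%:C%C.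
Proof.
rewrite /cmgf /cexpectation /mmt_gen_fun /= /cexp.
congr Complex.
  congr (fine (expectation _ _)); apply/funext => w /=.
  by rewrite !mulr0 mul0r subr0 addr0 cos0 mulr1 mulrC.
rewrite [X in expectation _ X](_ : _ = cst 0) ?expectation_cst//.
by apply/funext => w /=; rewrite !(mulr0, mul0r, addr0, sin0).
Qed.

End complex_mgf.

(* [C^o] carries the normed [C]-module structure of the complex field, so
   derivability in direction 1 is existence of the limit of
   (F (z + h) - F z) / h as the complex number h tends to 0. *)
Definition holomorphic_at (R : realType) (F : R[i] -> R[i]) (z : R[i]) : Prop :=
  let C : numFieldType := R[i] in
  derivable (F : C^o -> C^o) (z : C^o) (1 : C^o).

Definition mgf_entire d (T : measurableType d) (R : realType)
    (P : probability T R) (X : T -> R) : Prop :=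
  (forall z : R[i], cintegrable P (fun w => cexp (z * (X w)%:C%C))) /\
  (forall z : R[i], holomorphic_at (cmgf P X) z).

(* Main.v *)
(* Let sigma^2 be the variance of X with generating function f. All nonzero roots
   e^(i theta_j) of f lie on the unit circle, so |f(e^s)|^2 / f(1)^2 is, up to a
   power of e^s, the product of the factors 1 + (cosh s - 1) / (1 - cos theta_j).
   Moreover 2 sigma^2 is the sum of the 1 / (1 - cos theta_j), each of which is
   at least 1/2. Hence E exp(s (X - EX)) <= exp(sigma^2 (cosh s - 1)) and
   sigma >= 1/2, so that E exp(t |X^*|) is bounded by a function K(t) that is the
   same for all CGFs. With such a bound, convergence in distribution implies
   convergence of all moments and E exp(t |Y|) <= K(t) for the limit Y, whose
   moment generating function is therefore entire. The moments of Y determine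
   its law: they determine E cos(tY + phi) by a power series, hence the
   expectation of every trigonometric polynomial, and the half-line indicators
   are bounded pointwise limits of trigonometric polynomials. Conversely, if the
   moments converge, Helly selection along any ultrafilter yields a limit law;
   all these laws have the same moments and so are equal. *)

Require Import Defs.
From HB Require Import structures.
From mathcomp Require Import all_boot all_order all_algebra.
From mathcomp Require Import complex.
From mathcomp Require Import all_classical all_reals all_analysis.
From mathcomp Require Import measurable_realfun ring lra.

Set Implicit Arguments.
Unset Strict Implicit.
Unset Printing Implicit Defensive.

Import Order.TTheory GRing.Theory Num.Theory.
Import numFieldNormedType.Exports.

Local Open Scope classical_set_scope.
Local Open Scope ring_scope.

(** * Domination by exponential moments *)

(** Squaring [f] makes its factorization usable: [f] has real coefficients, so [f^2] is, up to a
    positive constant, the product over all roots [z] of [(X - z)(X - conj z)], each root being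
    paired with its own conjugate, real roots included. These quadratics may have negative
    coefficients and then belong to no law; hence mean, variance and centred moment generating
    function are functionals of a real polynomial, and probability returns only for [f] itself. The
    single bound [K] yields tightness, uniform integrability of all powers and exponential moments
    of the limit. A competitor with the same moments as the limit comes without exponential moments;
    they are recovered from its even moments before cosines can be integrated termwise. Convergence
    is treated along an arbitrary proper filter because moments must pass to the limit both along
    [\oo] and along ultrafilters. Along an ultrafilter the distribution functions converge at every
    real point at once, without diagonal extraction. *)

Lemma integrable_realZl (R : realType) d (T : measurableType d)
    (P : {measure set T -> \bar R}) (f : T -> R) (r : R) :
  P.-integrable setT (fun w => (f w)%:E) ->
  P.-integrable setT (fun w => (r * f w)%:E).
Proof. by move=> i; under eq_fun do rewrite EFinM; exact: integrableZl. Qed.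

(** The integral lives in [\bar R], so the bound carries integrability with it. With [|Y|] in the
    exponent, one hypothesis controls both tails and, through [|y|^n <= n! e^|y|], all powers. *)
Definition exp_moments_le (R : realType) d (T : measurableType d)
    (P : probability T R) (Y : T -> R) (K : R -> R) : Prop :=
  forall t : R, (\int[P]_w (expR (t * `|Y w|))%:E <= (K t)%:E)%E.

Lemma exp_coeff_le_expR (R : realType) (x : R) (n : nat) :
  0 <= x -> x ^+ n / n`!%:R <= expR x.
Proof.
move=> x0; case: n => [|n].
  by rewrite expr0 fact0 divr1 -expR0 ler_expR.
by apply: le_trans (expR_ge1Dxn n x0); rewrite lerDr.
Qed.

Lemma normrX_le_expR (R : realType) (y : R) (n : nat) :
  `|y ^+ n| <= n`!%:R * expR (1 * `|y|).
Proof.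
rewrite normrX mul1r mulrC -ler_pdivrMr ?ltr0n ?fact_gt0//.
exact: exp_coeff_le_expR.
Qed.

Lemma normrX_exp_le (R : realType) (y t : R) (n : nat) :
  `|y| ^+ n * expR (t * `|y|) <= n`!%:R * expR ((t + 1) * `|y|).
Proof.
rewrite mulrDl expRD mulrCA mulrC ler_wpM2l ?expR_ge0//.
by rewrite -normrX normrX_le_expR.
Qed.

Section exponential_domination.
Context (R : realType) d (T : measurableType d) (P : probability T R).
Variables (Y : {RV P >-> R}) (K : R -> R).
Hypothesis YK : exp_moments_le P Y K.

Lemma measurable_exp_abs (t : R) :
  measurable_fun setT (fun y : R => expR (t * `|y|)).
Proof.
by apply: measurableT_comp => //; apply: measurable_funM.
Qed.

Lemma integrable_exp_abs (t : R) :
  P.-integrable setT (fun w => (expR (t * `|Y w|))%:E).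
Proof.
apply/integrableP; split.
  apply/measurable_EFinP; apply: (measurableT_comp (measurable_exp_abs t)).
  exact: measurable_funPT.
under eq_integral do rewrite gee0_abs ?lee_fin ?expR_ge0//.
by apply: le_lt_trans (YK t) _; rewrite ltry.
Qed.

Lemma integrable_exp_dominated (g : R -> R) (C t : R) :
  measurable_fun setT g -> (forall y, `|g y| <= C * expR (t * `|y|)) ->
  P.-integrable setT (fun w => (g (Y w))%:E).
Proof.
move=> mg gle; apply: (@le_integrable _ _ _ _ _ _ _
    (fun w => (C%:E * (expR (t * `|Y w|))%:E)%E)) => //.
- by apply/measurable_EFinP; apply: measurableT_comp mg _; exact: measurable_funPT.
- move=> w _; rewrite /= lee_fin (le_trans (gle _))//.
  exact: ler_norm.
- exact: integrableZl (integrable_exp_abs t).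
Qed.

Lemma integrable_power (k : nat) : P.-integrable setT (fun w => (Y w ^+ k)%:E).
Proof.
apply: (integrable_exp_dominated (g := fun y => y ^+ k) (C := k`!%:R) (t := 1)).
  exact: measurable_funX.
by move=> y; exact: normrX_le_expR.
Qed.

Lemma Rintegral_exp_abs_le (t : R) : \int[P]_w expR (t * `|Y w|) <= K t.
Proof.
rewrite -lee_fin /Rintegral fineK; first exact: YK.
exact: integrable_fin_num (integrable_exp_abs t).
Qed.

Lemma normr_Rintegral_exp_dominated (g : R -> R) (C t : R) :
  measurable_fun setT g -> (forall y, `|g y| <= C * expR (t * `|y|)) ->
  `|\int[P]_w g (Y w)| <= C * K t.
Proof.
move=> mg gle; have C0 : 0 <= C.
  have := le_trans (normr_ge0 _) (gle 0).
  by rewrite pmulr_lge0 ?expR_gt0.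
have ig := integrable_exp_dominated mg gle.
apply: le_trans (le_normr_Rintegral _ _) _ => //.
apply: le_trans (_ : \int[P]_w (C * expR (t * `|Y w|)) <= _).
  apply: le_Rintegral => //.
  - by have := integrable_norm ig.
  - exact: integrableZl (integrable_exp_abs t).
rewrite RintegralZl//; last exact: integrable_exp_abs.
by rewrite ler_wpM2l// Rintegral_exp_abs_le.
Qed.

End exponential_domination.

(** * Generating functions with roots on the unit circle *)

Lemma expR_sub1_le (R : realType) (x : R) : expR x - 1 <= x * expR x.
Proof.
have := expR_ge1Dx (- x); rewrite expRN -(ler_pM2r (expR_gt0 x)).
by rewrite mulVf ?expR_eq0// mulrDl mul1r mulNr; lra.
Qed.

(** One has [0 <= e^x - 1 - x <= x (e^x - 1)]; the last factor is at most [x e^x] for [x >= 0], and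
    at least [x] for [x < 0]. *)
Lemma expR_Taylor1_le (R : realType) (x : R) :
  `|expR x - 1 - x| <= x ^+ 2 * expR `|x|.
Proof.
have h1 := expR_ge1Dx x; have h2 := expR_sub1_le x.
rewrite ger0_norm; last by lra.
have [x0|x0] := leP 0 x; first by rewrite ger0_norm//; nra.
have h3 : 1 <= expR `|x| by rewrite -expR0 ler_expR.
by nra.
Qed.

Section poly_statistics.
Context (R : realType).
Implicit Types (p q : {poly R}) (s : R).

(* Mean, variance and centred moment generating function of the law with masses
   [p`_k / p.[1]]; the term [p''(1) / p(1)] is E[X (X - 1)]. *)
Definition gf_mean p : R := p^`().[1] / p.[1].
Definition gf_var p : R := p^`()^`().[1] / p.[1] + gf_mean p - gf_mean p ^+ 2.
Definition gf_mgf p s : R := expR (- (s * gf_mean p)) * (p.[expR s] / p.[1]).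

Lemma gf_meanM p q : p.[1] != 0 -> q.[1] != 0 ->
  gf_mean (p * q) = gf_mean p + gf_mean q.
Proof. by move=> p0 q0; rewrite /gf_mean derivM !hornerE; field; rewrite p0 q0. Qed.

Lemma gf_varM p q : p.[1] != 0 -> q.[1] != 0 ->
  gf_var (p * q) = gf_var p + gf_var q.
Proof.
move=> p0 q0; rewrite /gf_var gf_meanM// /gf_mean.
by rewrite derivM derivD !derivM !(hornerD, hornerM); field; rewrite p0 q0.
Qed.

Lemma gf_mgfM p q s : p.[1] != 0 -> q.[1] != 0 ->
  gf_mgf (p * q) s = gf_mgf p s * gf_mgf q s.
Proof.
move=> p0 q0; rewrite /gf_mgf gf_meanM// mulrDr opprD expRD !hornerM.
by field; rewrite p0 q0.
Qed.

Definition cosh s : R := (expR s + expR (- s)) / 2.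

Lemma cosh_ge1 s : 1 <= cosh s.
Proof. by have := expR_ge1Dx s; have := expR_ge1Dx (- s); rewrite /cosh; lra. Qed.

(* The gap in the values of the variance makes a nonconstant law have variance
   bounded below, uniformly. *)
Definition gf_subgaussian p := [/\ 0 < p.[1], gf_var p = 0 \/ 1 / 2 <= gf_var p &
  forall s, 0 <= gf_mgf p s <= expR (gf_var p * (cosh s - 1))].

(** Variances add and centred moment generating functions multiply, as for independent sums. The
    lower bound 0 is what allows the two upper bounds to be multiplied. *)
Lemma gf_subgaussianM p q :
  gf_subgaussian p -> gf_subgaussian q -> gf_subgaussian (p * q).
Proof.
move=> [p1 vp Mp] [q1 vq Mq]; have p0 := lt0r_neq0 p1; have q0 := lt0r_neq0 q1.
split; first by rewrite hornerM mulr_gt0.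
  by rewrite gf_varM//; case: vp vq => [->|?] [->|?]; [left|right|right|right]; lra.
move=> s; have /andP[a b] := Mp s; have /andP[a' b'] := Mq s.
by rewrite gf_mgfM// gf_varM// mulrDl expRD mulr_ge0//= ler_pM.
Qed.

Lemma gf_subgaussianC (c : R) : 0 < c -> gf_subgaussian c%:P.
Proof.
move=> c0; have m0 : gf_mean c%:P = 0 by rewrite /gf_mean derivC horner0 mul0r.
have v0 : gf_var c%:P = 0 by rewrite /gf_var m0 derivC deriv0 horner0; ring.
split; [by rewrite hornerC|by left|move=> s].
rewrite v0 /gf_mgf m0 mulr0 oppr0 !hornerC divff ?lt0r_neq0// mul0r expR0.
by lra.
Qed.

Lemma gf_subgaussianX : gf_subgaussian 'X.
Proof.
have m0 : gf_mean 'X = 1 by rewrite /gf_mean derivX !hornerE; field.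
have v0 : gf_var 'X = 0 by rewrite /gf_var m0 derivX -polyC1 derivC horner0 mul0r; ring.
split; [by rewrite hornerX|by left|move=> s].
rewrite v0 /gf_mgf m0 mulr1 !hornerX divr1 -expRD addNr mul0r expR0.
by lra.
Qed.

(* The real quadratic with roots [exp (i theta)], [exp (- i theta)], where
   [c = cos theta]. *)
Lemma gf_subgaussian_unit_pair (c : R) : -1 <= c < 1 ->
  gf_subgaussian ('X^2 - (2 * c) *: 'X + 1).
Proof.
move=> /andP[c1 c2]; set p := _ + 1.
have px x : p.[x] = x ^+ 2 - 2 * c * x + 1 by rewrite /p !hornerE.
have p1 : p.[1] = 2 * (1 - c) by rewrite px; ring.
have p0 : p.[1] != 0 by rewrite p1; lra.
have c0 : 1 - c != 0 by lra.
have dp : p^`() = 2 *: 'X - (2 * c)%:P.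
  rewrite /p derivD derivB derivXn derivZ derivX -polyC1 derivC addr0.
  by rewrite expr1 scaler_nat -mul_polyC mulr1.
have ddp : p^`()^`() = 2%:P.
  by rewrite dp derivB derivZ derivX derivC subr0 -mul_polyC mulr1.
have m1 : gf_mean p = 1 by rewrite /gf_mean p1 dp !hornerE; field.
have v1 : gf_var p = (1 - c)^-1.
  by rewrite /gf_var m1 p1 ddp !hornerE; field.
split; [by rewrite p1; lra|right|move=> s].
  by rewrite v1 ler_pdivrMr ?ltr0n// mulrC ler_pdivlMr; lra.
(* The mean is 1, so the numerator is [e^{-s} p(e^s) = 2 (cosh s - c)], to be divided by
   [p(1) = 2 (1 - c)]. The bound is then [1 + x <= e^x]. *)
have -> : gf_mgf p s = 1 + gf_var p * (cosh s - 1).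
  rewrite v1 /gf_mgf m1 mulr1 p1 px /cosh expRN; field.
  by rewrite c0 expR_eq0.
rewrite expR_ge1Dx andbT addr_ge0// mulr_ge0//; first by rewrite v1 invr_ge0; lra.
by rewrite subr_ge0 cosh_ge1.
Qed.

End poly_statistics.

Section cgf_roots.
Context (R : realType).
Local Notation C := R[i].
Local Notation toC := (real_complex R).

Lemma root_of_unity_Re2Im2 (z : C) :
  is_root_of_unity z -> complex.Re z ^+ 2 + complex.Im z ^+ 2 = 1.
Proof.
case=> n n0 /unity_rootP zn.
have : `|z| ^+ n == 1 by rewrite -normrX zn normr1.
rewrite pexpr_eq1// normc_def => /eqP/complexI h.
by rewrite -(sqr_sqrtr (addr_ge0 (sqr_ge0 _) (sqr_ge0 _))) h expr1n.
Qed.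

(** The root 0 gives [X^2], the root -1 the extreme case [c = -1]. On the unit circle [z != 1] means
    [Re z < 1], which keeps the variance [1 / (1 - c)] finite. *)
Lemma root_pair_gf_subgaussian (z : C) : is_root_of_unity z \/ z = 0 -> z != 1 ->
  exists2 q : {poly R}, gf_subgaussian q &
    map_poly toC q = ('X - z%:P) * ('X - (conjc z)%:P).
Proof.
case=> [zu z1|-> _]; last first.
  exists ('X * 'X); first by apply: gf_subgaussianM; exact: gf_subgaussianX.
  by rewrite conjc0 subr0 rmorphM/= map_polyX.
have := root_of_unity_Re2Im2 zu; case: z z1 {zu} => a b /= ab1 ab.
exists ('X^2 - (2 * a) *: 'X + 1).
  apply: gf_subgaussian_unit_pair; apply/andP; split; first by nra.
  rewrite lt_neqAle; apply/andP; split; last by nra.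
  apply: contra ab1 => /eqP a1; rewrite eq_complex/= a1 eqxx/=.
  by rewrite -sqrf_eq0; apply/eqP; move: ab; rewrite a1; lra.
rewrite rmorphD rmorphB/= rmorph1 map_polyXn map_polyZ/= map_polyX.
have -> : ('X - (a +i* b)%C%:P) * ('X - (a -i* b)%C%:P) =
    'X^2 - ((a +i* b)%C + (a -i* b)%C)%:P * 'X + ((a +i* b)%C * (a -i* b)%C)%:P
    :> {poly C} by rewrite polyCD polyCM; ring.
rewrite -mul_polyC; congr (_ - _%:P * _ + _).
  by apply/eqP; rewrite eq_complex/=; apply/andP; split; apply/eqP; ring.
rewrite -polyC1; congr (_%:P); apply/eqP.
by rewrite eq_complex/=; apply/andP; split; apply/eqP; rewrite -?ab; ring.
Qed.

Lemma root_pairs_gf_subgaussian (r : seq C) :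
  (forall z, z \in r -> (is_root_of_unity z \/ z = 0) /\ z != 1) ->
  exists2 q : {poly R}, gf_subgaussian q &
    map_poly toC q = \prod_(z <- r) (('X - z%:P) * ('X - (conjc z)%:P)).
Proof.
elim: r => [_|z r IH zr].
  exists 1; last by rewrite rmorph1 big_nil.
  by rewrite -polyC1; apply: gf_subgaussianC.
have [|q qg qE] := IH; first by move=> u ur; apply: zr; rewrite inE ur orbT.
have [zu z1] := zr z (mem_head _ _).
have [p pg pE] := root_pair_gf_subgaussian zu z1.
exists (p * q); first exact: gf_subgaussianM.
by rewrite rmorphM/= big_cons pE qE.
Qed.

Definition gf_of (f : {poly int}) : {poly R} := map_poly intr f.

Lemma gf_of1 f : (gf_of f).[1] = (f.[1])%:~R.
Proof. by rewrite /gf_of -[in RHS]horner_map rmorph1. Qed.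

Lemma CGF_at1_gt0 f : is_CGF R f -> 0 < (gf_of f).[1].
Proof.
move=> [f0 fc _]; rewrite gf_of1 ltr0z horner_coef.
under eq_bigr do rewrite expr1n mulr1.
have sf : (size f).-1.+1 = size f by rewrite prednK// lt0n size_poly_eq0.
rewrite -sf big_ord_recr/= -lead_coefE ltr_wpDl//; first by apply: sumr_ge0 => i _.
by rewrite lt_def lead_coef_eq0 f0 lead_coefE fc.
Qed.

(** Conjugating the factorization of [f] leaves [f] unchanged; multiplying the two factorizations
    gives [f^2] as [|c|^2], with [c] the leading coefficient, times the product of the conjugate
    pairs. No root equals 1 because [f(1) > 0]. *)
Lemma CGF_sqr_gf_subgaussian f : is_CGF R f -> gf_subgaussian (gf_of f ^+ 2).
Proof.
move=> fCGF; have f1 := CGF_at1_gt0 fCGF; case: fCGF => f0 _ fr.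
have toCf : map_poly toC (gf_of f) = map_poly intr f.
  by rewrite /gf_of -map_poly_comp; apply: eq_map_poly => n /=; rewrite rmorph_int.
set fC : {poly C} := map_poly intr f in toCf fr *.
have fC0 : fC != 0 by rewrite -toCf map_poly_eq0; apply: contraTneq f1 => ->;
  rewrite horner0 ltxx.
have fC1 : fC.[1] != 0.
  by rewrite -toCf -[1](rmorph1 toC) horner_map fmorph_eq0 gt_eqF.
have conjf : map_poly conjc fC = fC.
  by rewrite /fC -map_poly_comp; apply: eq_map_poly => n /=; rewrite rmorph_int.
have [r fE] := closed_field_poly_normal fC.
set c := lead_coef fC in fE.
have c0 : c != 0 by rewrite lead_coef_eq0.
have conjE : fC = conjc c *: \prod_(z <- r) ('X - (conjc z)%:P).
  rewrite -conjf {1}fE map_polyZ/= rmorph_prod/=; congr (_ *: _).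
  by apply: eq_bigr => z _; rewrite rmorphB/= map_polyX map_polyC.
have [z zr|q qg qE] := @root_pairs_gf_subgaussian r.
  have zroot : root fC z by rewrite fE rootZ// root_prod_XsubC.
  by split; [exact: fr|apply: contraTneq zroot => ->; rewrite rootE].
have normE : c * conjc c = (complex.Re c ^+ 2 + complex.Im c ^+ 2)%:C%C.
  by case: (c) => a b; apply/eqP; rewrite eq_complex/=; apply/andP; split;
    apply/eqP; ring.
have -> : gf_of f ^+ 2 = (complex.Re c ^+ 2 + complex.Im c ^+ 2)%:P * q.
  apply: (@map_inj_poly _ _ toC) => //; first exact: complexI.
  rewrite rmorphXn rmorphM/= toCf map_polyC/= -normE qE big_split/=.
  by rewrite expr2 {1}fE conjE -!mul_polyC polyCM; ring.
apply: gf_subgaussianM qg; apply: gf_subgaussianC.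
rewrite lt_def addr_ge0 ?sqr_ge0// andbT; apply: contra c0.
by rewrite paddr_eq0 ?sqr_ge0// !sqrf_eq0 eq_complex.
Qed.

(** Both estimates descend from [f^2]: the variance gap 1/2 is halved, and the bound on the squared
    moment generating function admits a square root because the coefficients of [f] are
    nonnegative. *)
Lemma CGF_gf_mgf_le f : is_CGF R f -> 0 < gf_var (gf_of f) ->
  1 / 4 <= gf_var (gf_of f) /\
  forall s, gf_mgf (gf_of f) s <= expR (gf_var (gf_of f) * (cosh s - 1)).
Proof.
move=> fCGF v0; have f1 := CGF_at1_gt0 fCGF.
have [_ vf Mf] := CGF_sqr_gf_subgaussian fCGF.
rewrite expr2 in vf Mf; rewrite gf_varM ?gt_eqF// in vf Mf.
split; first by case: vf; lra.
move=> s; have /andP[_] := Mf s; rewrite gf_mgfM ?gt_eqF// mulrDl expRD -!expr2.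
rewrite ler_sqr ?nnegrE ?expR_ge0//.
rewrite /gf_mgf mulr_ge0 ?expR_ge0// divr_ge0 ?(ltW f1)//.
rewrite horner_coef sumr_ge0// => i _; rewrite mulr_ge0 ?exprn_ge0 ?expR_ge0//.
by case: fCGF => _ fc _; rewrite coef_map/= ler0z.
Qed.

End cgf_roots.

(** * Standardized CGF variables *)

Section finitely_supported.
Context (R : realType) d (T : measurableType d) (P : probability T R).
Variables (X : {RV P >-> R}) (n : nat) (p : nat -> R).
Hypothesis Xp : forall k, P (X @^-1` [set k%:R]) = (p k)%:E.
Hypothesis p1 : \sum_(k < n) p k = 1.

Let F (k : nat) := X @^-1` [set k%:R].

Let mF k : measurable (F k).
Proof. by rewrite /F -[_ @^-1` _]setTI; exact: measurable_funP. Qed.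

Let trivF : trivIset setT (fun k : 'I_n => F k).
Proof.
apply/trivIsetP => i j _ _ ij; apply/seteqP; split => // w; rewrite /F/= => -[-> /eqP].
by rewrite eqr_nat => /eqP/val_inj ji; rewrite ji eqxx in ij.
Qed.

(** The masses exhaust the probability, so the complement of the listed atoms is a null set and
    [g (X w)] is almost everywhere a finite sum of indicators. *)
Lemma integral_finitely_supported (g : R -> R) : measurable_fun setT g ->
  (\int[P]_w (g (X w))%:E = (\sum_(k < n) p k * g k%:R)%:E)%E.
Proof.
move=> mg; pose h w := (\sum_(k < n) (g k%:R)%:E * (\1_(F k) w)%:E)%E.
have mX : measurable_fun setT X by exact: measurable_funPT.
have ih (k : 'I_n) : P.-integrable setT (fun w => (g k%:R)%:E * (\1_(F k) w)%:E)%E.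
  by apply: integrableZl => //; exact: integrable_indic.
rewrite (@ae_eq_integral _ _ _ _ _ h)//=; last 3 first.
- by apply/measurable_EFinP; exact: measurableT_comp.
- by apply: emeasurable_sum => k; case/integrableP: (ih k).
- exists (~` \big[setU/set0]_(k < n) F k).
  have mU : measurable (\big[setU/set0]_(k < n) F k) by exact: bigsetU_measurable.
  split; first exact: measurableC.
    apply: etrans (probability_setC P mU) _; rewrite measure_bigsetU_ord//.
    rewrite (eq_bigr (fun k : 'I_n => (p k)%:E)) => [|k _]; last exact: Xp.
    by rewrite sumEFin p1 subee.
  apply: subsetC => w; rewrite -bigcup_mkord => -[k /= kn Xk] _.
  rewrite /h (bigD1 (Ordinal kn))//= big1 ?adde0 => [|i ik].
    by rewrite indicE mem_set// mule1; congr (g _)%:E.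
  rewrite indicE memNset ?mule0// /F/= Xk => /eqP.
  by rewrite eqr_nat => /eqP ki; move/eqP: ik; apply; exact: val_inj.
rewrite /h integral_sum// -sumEFin; apply: eq_bigr => k _.
rewrite integralZl//; last exact: integrable_indic.
by rewrite integral_indic// setIT mulrC EFinM; congr (_ * _)%E; exact: Xp.
Qed.

End finitely_supported.

Section gf_stats_sums.
Context (R : realType).
Implicit Types (p : {poly R}).

Lemma horner1_sum p : p.[1] = \sum_(k < size p) p`_k.
Proof. by rewrite horner_coef; apply: eq_bigr => i _; rewrite expr1n mulr1. Qed.

Lemma deriv1_sum p : p^`().[1] = \sum_(k < size p) p`_k * k%:R.
Proof.
rewrite -{1}[p]coefK poly_def raddf_sum/= horner_sum; apply: eq_bigr => k _.
by rewrite derivZ derivXn hornerZ hornerMn hornerXn expr1n.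
Qed.

Lemma deriv2_sum p :
  p^`()^`().[1] = \sum_(k < size p) p`_k * (k%:R ^+ 2 - k%:R).
Proof.
rewrite -{1}[p]coefK poly_def !raddf_sum/= horner_sum; apply: eq_bigr => k _.
rewrite derivZ derivXn derivZ derivMn derivXn hornerZ !hornerMn hornerXn expr1n.
congr (_ * _); case: (nat_of_ord k) => [|j]/=; first by rewrite mulr0n; ring.
by rewrite -mulrnA natrM -[in RHS]natr1; ring.
Qed.

Lemma gf_meanE p : gf_mean p = \sum_(k < size p) p`_k / p.[1] * k%:R.
Proof.
by rewrite /gf_mean deriv1_sum mulr_suml; apply: eq_bigr => k _; rewrite mulrAC.
Qed.

Lemma gf_varE p : p.[1] != 0 ->
  gf_var p = \sum_(k < size p) p`_k / p.[1] * (k%:R - gf_mean p) ^+ 2.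
Proof.
move=> p0; set m := gf_mean p.
transitivity (\sum_(k < size p) (p`_k * (k%:R ^+ 2 - k%:R) / p.[1] +
   (1 - 2 * m) * (p`_k / p.[1] * k%:R) + m ^+ 2 / p.[1] * p`_k)); last first.
  by apply: eq_bigr => k _; field.
rewrite !big_split/= -mulr_suml -!mulr_sumr -deriv2_sum -gf_meanE -horner1_sum.
by rewrite /gf_var -/m; field.
Qed.

Lemma gf_mgfE p s : gf_mgf p s =
  \sum_(k < size p) p`_k / p.[1] * expR (s * (k%:R - gf_mean p)).
Proof.
rewrite /gf_mgf horner_coef mulr_suml mulr_sumr; apply: eq_bigr => k _.
rewrite mulrBr expRB expRN -expRM_natl [k%:R * s]mulrC.
by rewrite -mulrA mulrCA [_^-1 * _]mulrC !mulrA; congr (_ / _); rewrite mulrAC.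
Qed.

End gf_stats_sums.

Lemma cosh_sub1_le (R : realType) (x : R) : cosh x - 1 <= x ^+ 2 * expR `|x|.
Proof.
have := le_trans (ler_norm _) (expR_Taylor1_le x).
have := le_trans (ler_norm _) (expR_Taylor1_le (- x)).
by rewrite normrN sqrrN /cosh => h1 h2; lra.
Qed.

Section CGF_random_variable.
Context (R : realType) d (T : measurableType d) (P : probability T R).
Variables (X : {RV P >-> R}) (f : {poly int}).
Hypotheses (fCGF : is_CGF R f) (Xf : corresponds_to X f).
Local Notation p := (gf_of R f).

Let f1 : p.[1] != 0. Proof. by rewrite gt_eqF// CGF_at1_gt0. Qed.

Lemma integral_corresponds_to (g : R -> R) : measurable_fun setT g ->
  (\int[P]_w (g (X w))%:E = (\sum_(k < size p) p`_k / p.[1] * g k%:R)%:E)%E.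
Proof.
move=> mg; rewrite (@integral_finitely_supported _ _ _ _ _ (size p)
    (fun k => p`_k / p.[1])) //.
- by move=> k; rewrite Xf gf_of1 coef_map.
- by rewrite -mulr_suml -horner1_sum divff.
Qed.

Lemma expectation_CGF : 'E_P[X]%E = (gf_mean p)%:E.
Proof.
rewrite unlock; apply: etrans (integral_corresponds_to (g := idfun) _) _.
  exact: measurable_id.
by rewrite gf_meanE.
Qed.

Lemma variance_CGF : 'V_P[X]%E = (gf_var p)%:E.
Proof.
rewrite /variance unlock expectation_CGF/= unlock.
apply: etrans (integral_corresponds_to
    (g := fun x => (x - gf_mean p) * (x - gf_mean p)) _) _.
  by apply: measurable_funM; apply: measurable_funB => //; exact: measurable_id.
by rewrite gf_varE//; congr EFin; apply: eq_bigr => k _; rewrite expr2.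
Qed.

(* The bound does not depend on [X]: with [sigma >= 1/2], the exponent
   [sigma^2 (cosh (t / sigma) - 1)] is at most [t^2 e^{|t| / sigma}]. *)
Lemma integral_exp_standardize_le (t : R) : (0 < 'V_P[X])%E ->
  (\int[P]_w (expR (t * standardize X w))%:E <=
   (expR (t ^+ 2 * expR (2 * `|t|)))%:E)%E.
Proof.
rewrite variance_CGF lte_fin => v0; have [v1 Mle] := CGF_gf_mgf_le fCGF v0.
set v := gf_var p in v0 v1 Mle; set sd := Num.sqrt v.
have sd0 : 0 < sd by rewrite sqrtr_gt0.
have sdv : sd ^+ 2 = v by rewrite sqr_sqrtr// ltW.
have sd1 : 1 / 2 <= sd by nra.
rewrite /standardize /= /standardize_fun expectation_CGF variance_CGF/= -/v -/sd.
rewrite (integral_corresponds_to (g := fun x => expR (t * ((x - gf_mean p) / sd)))).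
  rewrite (_ : \sum_(k < _) _ = gf_mgf p (t / sd)); last first.
    by rewrite gf_mgfE; apply: eq_bigr => k _; rewrite [t / sd * _]mulrAC mulrA.
  rewrite lee_fin (le_trans (Mle _))// ler_expR.
  rewrite (le_trans (ler_wpM2l (ltW v0) (cosh_sub1_le _)))//.
  rewrite mulrA -sdv -exprMn mulrCA divff ?gt_eqF// mulr1.
  rewrite ler_wpM2l ?sqr_ge0// ler_expR normrM normfV (gtr0_norm sd0) mulrC.
  by rewrite ler_wpM2r// invf_ple ?posrE//; lra.
apply: measurableT_comp => //; apply: measurable_funM => //.
by apply: measurable_funM => //; apply: measurable_funB => //; exact: measurable_id.
Qed.

Lemma exp_moments_standardize : (0 < 'V_P[X])%E ->
  exp_moments_le P (standardize X)
    (fun t => 2 * expR (t ^+ 2 * expR (2 * `|t|))).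
Proof.
(* [e^{t|z|} <= e^{tz} + e^{-tz}] for every real [t]. *)
move=> v0 t; pose Z := standardize X.
have mE (s : R) : measurable_fun setT (fun w => (expR (s * Z w))%:E).
  apply/measurable_EFinP; apply: measurableT_comp => //.
  by apply: measurable_funM => //; exact: measurable_funPT.
apply: (@le_trans _ _ (\int[P]_w ((expR (t * Z w))%:E + (expR (- t * Z w))%:E))%E).
  apply: ge0_le_integral => //.
  - apply/measurable_EFinP; apply: (measurableT_comp (measurable_exp_abs t)).
    exact: (measurable_funPT Z).
  - exact: emeasurable_funD (mE t) (mE (- t)).
  - move=> w _; rewrite -EFinD lee_fin -/Z.
    have [z0|z0] := leP 0 (Z w); first by rewrite ger0_norm// lerDl expR_ge0.
    by rewrite ltr0_norm// mulrN mulNr lerDr expR_ge0.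
rewrite ge0_integralD//.
- rewrite mulrDl mul1r EFinD; apply: leeD; first exact: integral_exp_standardize_le.
  by have := integral_exp_standardize_le (- t) v0; rewrite normrN sqrrN.
Qed.

End CGF_random_variable.

(** * Moments determine the law *)

Section moment_series.
Context (R : realType).

Lemma series_exp_coeff_le (x : R) n : 0 <= x -> series (exp_coeff x) n <= expR x.
Proof.
move=> x0; apply: nondecreasing_cvgn_le; last exact: is_cvg_series_exp_coeff.
apply: nondecreasing_series => k _ _.
by rewrite /exp_coeff/= divr_ge0// exprn_ge0.
Qed.

Lemma integral_power_series d (T : measurableType d) (P : probability T R)
    (Y : {RV P >-> R}) (a : nat -> R) n :
  (forall k, P.-integrable setT (fun w => (Y w ^+ k)%:E)) ->
  (\int[P]_w (series (fun k => a k * Y w ^+ k) n)%:E =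
   (series (fun k => (a k * \int[P]_w (Y w ^+ k))%R) n)%:E)%E.
Proof.
move=> iX; rewrite /Rintegral /series/=.
under eq_integral do rewrite -sumEFin.
rewrite integral_sum//; last first.
  by move=> k; under eq_fun do rewrite EFinM; exact: integrableZl.
rewrite -sumEFin; apply: eq_bigr => k _; under eq_integral do rewrite EFinM.
by rewrite integralZl// EFinM fineK// integrable_fin_num.
Qed.

Section fixed_variable.
Context d (T : measurableType d) (P : probability T R).
Variables (Y : {RV P >-> R}) (K : R -> R).
Hypothesis YK : exp_moments_le P Y K.
Variables (a : nat -> R) (C t : R).
Hypotheses (t0 : 0 <= t) (aC : forall k, `|a k| <= C * (t ^+ k / k`!%:R)).

Let C_ge0 : 0 <= C.
Proof.
by have := le_trans (normr_ge0 _) (aC 0); rewrite expr0 fact0 divr1 mulr1.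
Qed.

Lemma power_series_le (y : R) n :
  `|series (fun k => a k * y ^+ k) n| <= C * expR (t * `|y|).
Proof.
rewrite /series/= (le_trans (ler_norm_sum _ _ _))//.
apply: (@le_trans _ _ (C * series (exp_coeff (t * `|y|)) n)).
  rewrite /series/= mulr_sumr ler_sum// => k _.
  rewrite normrM normrX /exp_coeff/= exprMn mulrAC mulrA.
  by rewrite ler_wpM2r ?exprn_ge0.
by rewrite ler_wpM2l ?C_ge0// series_exp_coeff_le// mulr_ge0.
Qed.

Lemma measurable_power_series n :
  measurable_fun setT (fun y : R => series (fun k => a k * y ^+ k) n).
Proof.
rewrite /series/=; apply: measurable_sum => k.
by apply: measurable_funM => //; exact: measurable_funX.
Qed.

(** Dominated convergence, all partial sums being bounded by [C * expR (t * |y|)]. The left-hand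
    side depends on [Y] through its moments only. *)
Lemma cvg_Rintegral_power_series (g : R -> R) :
  measurable_fun setT g ->
  (forall y, series (fun k => a k * y ^+ k) @ \oo --> g y) ->
  series (fun k => a k * \int[P]_w (Y w ^+ k)) @ \oo --> \int[P]_w g (Y w).
Proof.
move=> mg ag.
have gC y : `|g y| <= C * expR (t * `|y|).
  rewrite -(cvg_lim (@Rhausdorff R) (cvg_norm (ag y))).
  apply: limr_le; first by apply/cvg_ex; exists `|g y|; exact: cvg_norm (ag y).
  by apply: nearW => n; exact: power_series_le.
rewrite -(_ : (fun n => \int[P]_w series (fun k => a k * Y w ^+ k) n) =
   series (fun k => a k * \int[P]_w (Y w ^+ k))); last first.
  apply/funext => n; rewrite /Rintegral integral_power_series//.
  exact: (integrable_power YK).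
apply: fine_cvg; rewrite /Rintegral fineK; last first.
  exact: integrable_fin_num (integrable_exp_dominated YK mg gC).
case: (@dominated_convergence _ _ _ P setT measurableT
  (fun n w => (series (fun k => a k * Y w ^+ k) n)%:E) (fun w => (g (Y w))%:E)
  (fun w => (C * expR (t * `|Y w|))%:E)) => //.
- move=> n; apply/measurable_EFinP.
  exact: (measurableT_comp (measurable_power_series n)).
- by apply/measurable_EFinP; exact: measurableT_comp.
- by apply/aeW => w _; apply: cvg_EFin; [exact: nearW|exact: ag].
- under eq_fun do rewrite EFinM; apply: integrableZl => //.
  exact: (integrable_exp_abs YK).
- by apply/aeW => w n _; rewrite /= lee_fin power_series_le.
Qed.

End fixed_variable.
End moment_series.

Section cosine_moments.
Context (R : realType).

(** Taylor coefficients in [y] of [cos (t y + phi)]. The phase keeps sines, and the shifts produced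
    by product formulas, within one family. *)
Let b (t phi : R) k :=
  cos phi * (t ^+ k * cos_coeff 1 k) - sin phi * (t ^+ k * sin_coeff 1 k).

Lemma cos_shift_series (t phi y : R) :
  series (fun k => b t phi k * y ^+ k) @ \oo --> cos (t * y + phi).
Proof.
rewrite cosD [cos (t * y) * _]mulrC [sin (t * y) * _]mulrC.
have -> : series (fun k => b t phi k * y ^+ k) = (fun n =>
   cos phi * series (cos_coeff (t * y)) n - sin phi * series (sin_coeff (t * y)) n).
  apply/funext => n; rewrite /series/= !mulr_sumr -sumrB.
  apply: eq_bigr => k _; rewrite /b mulrBl; congr (_ - _); rewrite -!mulrA; congr (_ * _).
    by rewrite /cos_coeff/= exprMn expr1n; ring.
  by rewrite /sin_coeff/= exprMn expr1n; ring.
apply: cvgB; apply: cvgMr.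
  by rewrite unlock; exact: is_cvg_series_cos_coeff.
by rewrite unlock; exact: is_cvg_series_sin_coeff.
Qed.

Lemma normr_cos_shift_coeff_le (t phi : R) k :
  `|b t phi k| <= 2 * (`|t| ^+ k / k`!%:R).
Proof.
have c1 : `|cos_coeff 1 k : R| <= k`!%:R^-1.
  rewrite /cos_coeff/= expr1n mulr1 normrM normfV normr_nat ler_piMl ?invr_ge0//.
  by case: (odd k); rewrite /= ?(mul0r, mul1r, normr0, normrX, normrN1, expr1n).
have s1 : `|sin_coeff 1 k : R| <= k`!%:R^-1.
  rewrite /sin_coeff/= expr1n mulr1 normrM normfV normr_nat ler_piMl ?invr_ge0//.
  by case: (odd k); rewrite /= ?(mul0r, mul1r, normr0, normrX, normrN1, expr1n).
rewrite /b; move: (cos_coeff 1 k) (sin_coeff 1 k) c1 s1 => u v c1 s1.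
rewrite mulrDl mul1r (le_trans (ler_normB _ _))// lerD//.
  rewrite !normrM normrX -[leRHS]mul1r ler_pM ?cos_max ?mulr_ge0 ?exprn_ge0//.
  by rewrite ler_wpM2l ?exprn_ge0.
rewrite !normrM normrX -[leRHS]mul1r ler_pM ?sin_max ?mulr_ge0 ?exprn_ge0//.
by rewrite ler_wpM2l ?exprn_ge0.
Qed.

Lemma measurable_cos_shift (t phi : R) :
  measurable_fun setT (fun y => cos (t * y + phi)).
Proof.
apply: measurableT_comp; last by apply: measurable_funD => //; exact: measurable_funM.
by apply: continuous_measurable_fun; exact: continuous_cos.
Qed.

Context d (T : measurableType d) (P : probability T R)
  d' (T' : measurableType d') (P' : probability T' R).
Variables (Y : {RV P >-> R}) (Y' : {RV P' >-> R}) (K K' : R -> R).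
Hypotheses (YK : exp_moments_le P Y K) (YK' : exp_moments_le P' Y' K').
Hypothesis eq_moments :
  forall k, \int[P]_w (Y w ^+ k) = \int[P']_w (Y' w ^+ k).

Lemma eq_moments_cos (t phi : R) :
  \int[P]_w cos (t * Y w + phi) = \int[P']_w cos (t * Y' w + phi).
Proof.
have h := cvg_Rintegral_power_series YK (normr_ge0 t)
  (normr_cos_shift_coeff_le t phi) (measurable_cos_shift t phi) (@cos_shift_series t phi).
have h' := cvg_Rintegral_power_series YK' (normr_ge0 t)
  (normr_cos_shift_coeff_le t phi) (measurable_cos_shift t phi) (@cos_shift_series t phi).
apply: cvg_unique h _ => //.
rewrite (_ : (fun k => b t phi k * _) = fun k => b t phi k * \int[P']_w (Y' w ^+ k))//.
by apply/funext => k; rewrite eq_moments.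
Qed.

End cosine_moments.

Section equal_moments.
Context (R : realType).
Context d (T : measurableType d) (P : probability T R)
  d' (T' : measurableType d') (P' : probability T' R).
Variables (Y : {RV P >-> R}) (Y' : {RV P' >-> R}) (K : R -> R).
Hypothesis YK : exp_moments_le P Y K.
Hypothesis Y'int : forall k, P'.-integrable setT (fun w => (Y' w ^+ k)%:E).
Hypothesis eq_moments :
  forall k, \int[P]_w (Y w ^+ k) = \int[P']_w (Y' w ^+ k).

(* [e^{tx} + e^{-tx}] is a power series all of whose terms are nonnegative, so
   its integral is computed termwise by monotone convergence. *)
Lemma exp_moments_le_eq_moments : exp_moments_le P' Y' (fun t => 2 * K `|t|).
Proof.
move=> t; pose a k : R := (1 + (-1) ^+ k) * (t ^+ k / k`!%:R).
pose S n y := series (fun k => a k * y ^+ k) n.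
have a_le k : `|a k| <= 2 * (`|t| ^+ k / k`!%:R).
  rewrite normrM normrM normfV normr_nat normrX ler_wpM2r//.
  by rewrite (le_trans (ler_normD _ _))// normrX normrN1 expr1n normr1.
have a_ge0 k y : 0 <= a k * y ^+ k.
  rewrite /a -signr_odd; case: (boolP (odd k)) => ok /=.
    by rewrite expr1 subrr !mul0r.
  rewrite expr0 -mulrA mulr_ge0// mulrAC -exprMn divr_ge0//.
  by rewrite exprn_even_ge0.
have S_cvg y : S n y @[n --> \oo] --> expR (t * y) + expR (- (t * y)).
  rewrite (_ : S^~ y = fun n =>
      series (exp_coeff (t * y)) n + series (exp_coeff (- (t * y))) n).
    by apply: cvgD; exact: is_cvg_series_exp_coeff.
  apply/funext => n; rewrite /S /series/= -big_split/=; apply: eq_bigr => k _.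
  by rewrite /a /exp_coeff/= -[- (t * y)]mulN1r !exprMn; ring.
have mS n : measurable_fun setT (fun w => (S n (Y' w))%:E).
  by apply/measurable_EFinP; exact: (measurableT_comp (measurable_power_series a n)).
have S_homo w : {homo S^~ (Y' w) : n m / (n <= m)%N >-> n <= m}.
  by apply: nondecreasing_series => k _ _; exact: a_ge0.
have S_ge0 n w : 0 <= S n (Y' w) by rewrite /S /series/= sumr_ge0.
apply: (@le_trans _ _ (\int[P']_w limn (fun n => (S n (Y' w))%:E))%E).
  apply: ge0_le_integral => //.
  - apply/measurable_EFinP; apply: (measurableT_comp (measurable_exp_abs t)).
    exact: measurable_funPT.
  - rewrite (_ : (fun w => _) = fun w => (expR (t * Y' w) + expR (- (t * Y' w)))%:E).
      apply/measurable_EFinP; apply: measurable_funD; apply: measurableT_comp => //.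
        exact: measurable_funM.
      by apply: measurableT_comp => //; exact: measurable_funM.
    by apply/funext => w; apply/cvg_lim => //; apply: cvg_EFin; [exact: nearW|exact: S_cvg].
  - move=> w _; rewrite (_ : limn _ = (expR (t * Y' w) + expR (- (t * Y' w)))%:E).
      rewrite lee_fin; have [z0|z0] := leP 0 (Y' w).
        by rewrite ger0_norm// lerDl expR_ge0.
      by rewrite ltr0_norm// mulrN lerDr expR_ge0.
    by apply/cvg_lim => //; apply: cvg_EFin; [exact: nearW|exact: S_cvg].
have int_cvg : (\int[P']_w (S n (Y' w))%:E @[n --> \oo] -->
    \int[P']_w limn (fun n => (S n (Y' w))%:E))%E.
  apply: cvg_monotone_convergence => //.
  - by move=> n w _; rewrite lee_fin.
  - by move=> w _ n m nm; rewrite lee_fin S_homo.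
rewrite -(cvg_lim _ int_cvg)//; apply: lime_le; first by apply/cvg_ex; eexists; exact: int_cvg.
apply: nearW => n; rewrite /S integral_power_series// lee_fin.
(* A partial sum involves finitely many moments, so it can be integrated against [Y] instead, where
   it is at most [2 e^(|t| |y|)]. *)
under [X in series X]eq_fun do rewrite -eq_moments.
have := integral_power_series a n (integrable_power YK).
move/(congr1 fine) => /= <-; apply: le_trans (ler_norm _) _.
apply: (normr_Rintegral_exp_dominated YK (measurable_power_series a n)) => y.
by apply: power_series_le a_le _ _; rewrite normr_ge0.
Qed.

End equal_moments.

(** * Trigonometric polynomials as test functions *)

Section trigonometric_tests.
Context (R : realType).
Context d (T : measurableType d) (P : probability T R)
  d' (T' : measurableType d') (P' : probability T' R).
Variables (Y : {RV P >-> R}) (Y' : {RV P' >-> R}) (K K' : R -> R).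
Hypotheses (YK : exp_moments_le P Y K) (YK' : exp_moments_le P' Y' K').
Hypothesis eq_moments :
  forall k, \int[P]_w (Y w ^+ k) = \int[P']_w (Y' w ^+ k).

Definition bounded_measurable (g : R -> R) : Prop :=
  measurable_fun setT g /\ exists B, forall y, `|g y| <= B.

Lemma integrable_bounded_measurable d0 (T0 : measurableType d0)
    (P0 : probability T0 R) (Y0 : {RV P0 >-> R}) g :
  bounded_measurable g -> P0.-integrable setT (fun w => (g (Y0 w))%:E).
Proof.
move=> [mg [B gB]]; apply: measurable_bounded_integrable => //.
- by rewrite (le_lt_trans (probability_le1 _ _))// ltry.
- exact: measurableT_comp.
- exists B; split; first exact: num_real.
  by move=> M BM w _ /=; rewrite (le_trans (gB _))// ltW.
Qed.

Lemma bounded_measurableM g h : bounded_measurable g -> bounded_measurable h ->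
  bounded_measurable (fun y => g y * h y).
Proof.
move=> [mg [B gB]] [mh [B' hB]]; split; first exact: measurable_funM.
by exists (B * B') => y; rewrite normrM ler_pM.
Qed.

Lemma bounded_measurable_cos (t phi : R) :
  bounded_measurable (fun y => cos (t * y + phi)).
Proof. by split; [exact: measurable_cos_shift|exists 1 => y; exact: cos_max]. Qed.

(* Keeping the factor [cos (t y + phi)] makes this class stable under
   multiplication by cosines, so that it contains every trigonometric
   polynomial. *)
Definition same_cos_moments (g : R -> R) : Prop := bounded_measurable g /\
  forall t phi, \int[P]_w (g (Y w) * cos (t * Y w + phi)) =
                \int[P']_w (g (Y' w) * cos (t * Y' w + phi)).

Lemma same_cos_moments1 : same_cos_moments (fun=> 1).
Proof.
split; first by split => //; exists 1 => y; rewrite normr1.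
move=> t phi; apply: etrans (etrans (eq_moments_cos YK YK' eq_moments t phi) _);
  by apply: eq_Rintegral => w _; rewrite mul1r.
Qed.

Lemma same_cos_moments_lin (a b : R) g h :
  same_cos_moments g -> same_cos_moments h ->
  same_cos_moments (fun y => a * g y + b * h y).
Proof.
move=> [[mg [B gB]] gE] [[mh [B' hB]] hE]; split.
  split; first by apply: measurable_funD; exact: measurable_funM.
  exists (`|a| * B + `|b| * B') => y; rewrite (le_trans (ler_normD _ _))//.
  by rewrite !normrM lerD// ler_wpM2l.
have E d0 (T0 : measurableType d0) (P0 : probability T0 R) (Y0 : {RV P0 >-> R}) t phi :
    \int[P0]_w ((a * g (Y0 w) + b * h (Y0 w)) * cos (t * Y0 w + phi)) =
    a * \int[P0]_w (g (Y0 w) * cos (t * Y0 w + phi)) +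
    b * \int[P0]_w (h (Y0 w) * cos (t * Y0 w + phi)).
  have ig : P0.-integrable setT (fun w => (g (Y0 w) * cos (t * Y0 w + phi))%:E).
    apply: (@integrable_bounded_measurable _ _ _ _
      (fun y => g y * cos (t * y + phi))).
    by apply: bounded_measurableM (bounded_measurable_cos _ _); split => //; exists B.
  have ih : P0.-integrable setT (fun w => (h (Y0 w) * cos (t * Y0 w + phi))%:E).
    apply: (@integrable_bounded_measurable _ _ _ _
      (fun y => h y * cos (t * y + phi))).
    by apply: bounded_measurableM (bounded_measurable_cos _ _); split => //; exists B'.
  rewrite -!RintegralZl// -RintegralD//; last 2 first.
  - exact: integrable_realZl.
  - exact: integrable_realZl.
  by apply: eq_Rintegral => w _; ring.
by move=> t phi; rewrite !E gE hE.
Qed.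

(** The product-to-sum formula turns the two cosines into cosines of parameters [s + t] and [s - t],
    which the quantification over [t] and [phi] already covers. *)
Lemma same_cos_moments_cos (s psi : R) g : same_cos_moments g ->
  same_cos_moments (fun y => cos (s * y + psi) * g y).
Proof.
move=> [bg gE]; split; first exact: bounded_measurableM (bounded_measurable_cos _ _) bg.
have E d0 (T0 : measurableType d0) (P0 : probability T0 R) (Y0 : {RV P0 >-> R}) t phi :
    \int[P0]_w ((cos (s * Y0 w + psi) * g (Y0 w)) * cos (t * Y0 w + phi)) =
    2^-1 * \int[P0]_w (g (Y0 w) * cos ((s + t) * Y0 w + (psi + phi))) +
    2^-1 * \int[P0]_w (g (Y0 w) * cos ((s - t) * Y0 w + (psi - phi))).
  have i u xi : P0.-integrable setT (fun w => (g (Y0 w) * cos (u * Y0 w + xi))%:E).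
    apply: (@integrable_bounded_measurable _ _ _ _
      (fun y => g y * cos (u * y + xi))).
    exact: bounded_measurableM (bounded_measurable_cos _ _).
  rewrite -(RintegralZl _ _ (i (s + t) _))// -(RintegralZl _ _ (i (s - t) _))//.
  rewrite -RintegralD//; last 2 first.
  - exact: integrable_realZl.
  - exact: integrable_realZl.
  apply: eq_Rintegral => w _.
  rewrite (_ : (s + t) * _ + _ = (s * Y0 w + psi) + (t * Y0 w + phi)); last by ring.
  rewrite (_ : (s - t) * _ + _ = (s * Y0 w + psi) - (t * Y0 w + phi)); last by ring.
  by move: (s * _ + _) (t * _ + _) => u v; rewrite cosD cosB; field.
by move=> t phi; rewrite !E !gE.
Qed.

(** With [u = (1 + cos) / 2] and [m = 2 ^ n], the value [(1 - u^n)^m] tends to 1 where [u < 1/2] and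
    to 0 where [u > 1/2]: an approximate indicator of the set where the cosine is negative. *)
Definition cutoff (s psi : R) (n m : nat) (y : R) : R :=
  (1 - ((1 + cos (s * y + psi)) / 2) ^+ n) ^+ m.

Lemma same_cos_moments_cutoff s psi n m : same_cos_moments (cutoff s psi n m).
Proof.
have vH g : same_cos_moments g ->
    same_cos_moments (fun y => (1 + cos (s * y + psi)) / 2 * g y).
  move=> gH; have := same_cos_moments_lin 2^-1 2^-1 gH (same_cos_moments_cos s psi gH).
  by congr same_cos_moments; apply/funext => y; field.
have vnH g k : same_cos_moments g ->
    same_cos_moments (fun y => ((1 + cos (s * y + psi)) / 2) ^+ k * g y).
  move=> gH; elim: k => [|k IH].
    by under eq_fun do rewrite expr0 mul1r.
  by have := vH _ IH; under eq_fun do rewrite mulrA -exprS.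
rewrite /cutoff; elim: m => [|m IH].
  by under eq_fun do rewrite expr0; exact: same_cos_moments1.
have := same_cos_moments_lin 1 (-1) IH (vnH _ n IH).
by congr same_cos_moments; apply/funext => y; rewrite exprS; ring.
Qed.

Lemma Rintegral_cutoff s psi n m :
  \int[P]_w cutoff s psi n m (Y w) = \int[P']_w cutoff s psi n m (Y' w).
Proof.
have [_ /(_ 0 0) h] := same_cos_moments_cutoff s psi n m.
by apply: etrans (etrans h _); apply: eq_Rintegral => w _;
  rewrite mul0r addr0 cos0 mulr1.
Qed.

End trigonometric_tests.

(** * Elementary bounds for sine, cosine and powers *)

Section trigonometric_bounds.
Context (R : realType).
Implicit Types x y : R.

Lemma cos_ge_cos1 x : `|x| <= 1 -> cos 1 <= cos x.
Proof.
move=> x1; rewrite -[cos x]cos_norm le_eqVlt; case: (eqVneq `|x| 1) => [->|xn].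
  by rewrite eqxx.
have p2 : 1 <= pi :> R by rewrite (le_trans _ (@pi_ge2 R))// ler1n.
rewrite ltr_cos ?in_itv/= ?normr_ge0 ?(le_trans x1)//; last by rewrite ler01.
by rewrite lt_neqAle xn x1 orbT.
Qed.

Lemma sin_MVT x : exists2 c, `|c| <= `|x| & sin x = cos c * x.
Proof.
have cs a b : {within `[a, b], continuous (@sin R)}.
  by apply: continuous_subspaceT; exact: continuous_sin.
have [x0|x0] := leP 0 x.
  have [c] := @MVT_segment R sin cos 0 x x0 (fun y _ => is_derive_sin y) (cs _ _).
  rewrite in_itv/= => /andP[c0 cx]; rewrite sin0 !subr0 => ->.
  by exists c; rewrite // !ger0_norm.
have [c] :=
  @MVT_segment R sin cos x 0 (ltW x0) (fun y _ => is_derive_sin y) (cs _ _).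
rewrite in_itv/= => /andP[cx c0]; rewrite sin0 !sub0r mulrN => /oppr_inj ->.
by exists c => //; rewrite (ler0_norm c0) (ltr0_norm x0) lerN2.
Qed.

Lemma sin_ge_linear x : 0 <= x <= 1 -> cos 1 * x <= sin x.
Proof.
move=> /andP[x0 x1]; have [c cx ->] := sin_MVT x.
by rewrite ler_wpM2r// cos_ge_cos1// (le_trans cx)// ger0_norm.
Qed.

Lemma normr_sin_le x : `|sin x| <= `|x|.
Proof.
have [c _ ->] := sin_MVT x.
by rewrite normrM ler_piMl// cos_max.
Qed.

Lemma one_sub_cos_le x : 0 <= 1 - cos x <= x ^+ 2.
Proof.
rewrite subr_ge0 cos_le1/=.
have -> : 1 - cos x = 2 * sin (x / 2) ^+ 2.
  by rewrite sin2cos2 {1}(_ : x = (x / 2) *+ 2) ?cos_mulr2n; [ring|rewrite mulr2n; field].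
have := normr_sin_le (x / 2); rewrite -(ler_pXn2r (n := 2)) ?nnegrE// !(real_normK (num_real _)).
by rewrite expr_div_n; nra.
Qed.

Lemma normr_sin_sub_le x : `|sin x - x| <= 2 * x ^+ 2.
Proof.
have [c cx ->] := sin_MVT x.
rewrite (_ : _ - x = - ((1 - cos c) * x)); last by ring.
rewrite normrN normrM.
have /andP[h0 h1] := one_sub_cos_le c.
rewrite -[x ^+ 2](real_normK (num_real _)) expr2 mulrA ler_wpM2r//.
(* What remains is [1 - cos c <= 2 |c|]: from the bound [c^2] when [|c| <= 1], from the bound 2
   otherwise. *)
rewrite ger0_norm// (le_trans _ (_ : 2 * `|c| <= _)) ?ler_wpM2l//.
have h2 := cos_geN1 c; have c0 := normr_ge0 c.
have [c1|c1] := leP `|c| 1; last by lra.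
by move: h1; rewrite -(real_normK (num_real c)) => h1; nra.
Qed.

Lemma bernoulli_one_sub (a : R) n : 0 <= a <= 1 -> 1 - n%:R * a <= (1 - a) ^+ n.
Proof.
move=> /andP[a0 a1]; elim: n => [|n IH]; first by rewrite mul0r subr0 expr0.
have a1' : 0 <= 1 - a by rewrite subr_ge0.
rewrite exprS; apply: le_trans (ler_wpM2l a1' IH).
have : 0 <= n%:R * a ^+ 2 by rewrite mulr_ge0// sqr_ge0.
by rewrite -natr1 => h; nra.
Qed.

Lemma bernoulli_one_add (a : R) n : 0 <= a -> 1 + n%:R * a <= (1 + a) ^+ n.
Proof.
move=> a0; elim: n => [|n IH]; first by rewrite mul0r addr0 expr0.
have a1' : 0 <= 1 + a by rewrite addr_ge0.
rewrite exprS; apply: le_trans (ler_wpM2l a1' IH).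
have : 0 <= n%:R * a ^+ 2 by rewrite mulr_ge0// sqr_ge0.
by rewrite -natr1 => h; nra.
Qed.

Lemma one_add_expn_le (a : R) n : -1 <= a -> (1 + a) ^+ n <= expR (n%:R * a).
Proof.
move=> a1; rewrite expRM_natl lerXn2r ?nnegrE ?expR_ge0 ?expR_ge1Dx//.
by rewrite -lerBlDl sub0r.
Qed.

End trigonometric_bounds.

(** * Half-line indicators as limits of trigonometric polynomials *)

Section cutoff_limit.
Context (R : realType).
Implicit Types (x y s : R).

(* Bernstein-type cutoff: with [2u = 1 + s] the factor [(1 - u^n)^(2^n)] lies
   between [1 - (1+s)^n] and [exp (- (1+s)^n)]. *)
Lemma cutoff_core_lo s n : -1 <= s <= 1 ->
  1 - expR (n%:R * s) <= (1 - ((1 + s) / 2) ^+ n) ^+ (2 ^ n).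
Proof.
move=> /andP[s0 s1].
have u0 : 0 <= (1 + s) / 2 by lra.
have u1 : ((1 + s) / 2) ^+ n <= 1 by rewrite exprn_ile1//; lra.
apply: le_trans (bernoulli_one_sub _ _); last by rewrite exprn_ge0.
rewrite natrX -exprMn lerD2l lerN2 (_ : 2 * _ = 1 + s); last by field.
exact: one_add_expn_le.
Qed.

Lemma cutoff_core_hi s n : 0 <= s <= 1 ->
  (1 - ((1 + s) / 2) ^+ n) ^+ (2 ^ n) <= expR (- (n%:R * s)).
Proof.
move=> /andP[s0 s1].
have u0 : 0 <= (1 + s) / 2 by lra.
have u1 : ((1 + s) / 2) ^+ n <= 1 by rewrite exprn_ile1//; lra.
apply: le_trans (one_add_expn_le _ _) _; first by rewrite lerN2.
rewrite ler_expR mulrN lerN2 natrX -exprMn (_ : 2 * _ = 1 + s); last by field.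
by apply: le_trans (bernoulli_one_add n s0); rewrite lerDr.
Qed.

Lemma cutoff_ge0_le1 s psi n m y : 0 <= cutoff s psi n m y <= 1.
Proof.
rewrite /cutoff; set u := (1 + _) / 2.
have := cos_geN1 (s * y + psi); have := cos_le1 (s * y + psi) => h1 h2.
have u0 : 0 <= u by rewrite /u; lra.
have u1 : u ^+ n <= 1 by rewrite exprn_ile1// /u; lra.
by rewrite exprn_ge0 ?exprn_ile1 ?subr_ge0// lerBlDr lerDl exprn_ge0.
Qed.

(** The phase [- pi / 2] makes the cosine equal to the sine of [(y - x - 1/L) / L]. Dividing by [L]
    sends the period to infinity; the shift [1/L] puts [y = x] strictly on the side where the limit
    is 1, as the closed half-line of a distribution function requires. There the sine is only known
    to be below [- cos 1 / L^2], which the exponent [L^4] outweighs. *)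
Definition step_cutoff x (j : nat) : R -> R :=
  let L : R := j.+1%:R in
  cutoff L^-1 (- ((x + L^-1) / L) - pi / 2) (j.+1 ^ 4) (2 ^ (j.+1 ^ 4)).

Lemma step_cutoffE x j y : step_cutoff x j y =
  (1 - ((1 + sin ((y - x - j.+1%:R^-1) / j.+1%:R)) / 2) ^+ (j.+1 ^ 4))
     ^+ (2 ^ (j.+1 ^ 4)).
Proof.
rewrite /step_cutoff /cutoff.
rewrite (_ : _ * y + _ = (y - x - j.+1%:R^-1) / j.+1%:R - pi / 2) ?cosBpihalf//.
by ring.
Qed.

Lemma cvg_invn (c : R) : (c * j.+1%:R)^-1 @[j --> \oo] --> (0 : R).
Proof.
under eq_fun do rewrite invfM.
have : c^-1 * harmonic j @[j --> \oo] --> c^-1 * 0 by apply: cvgMr; exact: cvg_harmonic.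
by rewrite mulr0.
Qed.

Lemma near_natr_ge (M : R) : \forall j \near \oo, M <= j.+1%:R.
Proof.
near=> j; apply: (@le_trans _ _ j%:R); last by rewrite ler_nat.
by near: j; exact: nbhs_infty_ger.
Unshelve. all: by end_near. Qed.

(** Since [sin t >= t cos 1] on [[0, 1]], the sine [s] is so far from 0 that [L^4 |s|] is at least a
    constant multiple of [L]; then [e^{-r} <= 1/r] squeezes the error by a multiple of [1/L]. *)
Lemma cvg_step_cutoff x y :
  step_cutoff x j y @[j --> \oo] --> (\1_`]-oo, x] y : R).
Proof.
have k0 : 0 < cos 1 :> R := cos1_gt0 R.
set k := cos 1 in k0; rewrite indicE.
have [yx|xy] := leP y x.
  rewrite mem_set/= ?in_itv//.
  have cv : 1 - (k * j.+1%:R)^-1 @[j --> \oo] --> (1 : R).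
    have : 1 - (k * j.+1%:R)^-1 @[j --> \oo] --> 1 - (0 : R).
      by apply: cvgB; [exact: cvg_cst|exact: cvg_invn].
    by rewrite subr0.
  apply: (squeeze_cvgr _ cv (cvg_cst _)).
  near=> j; rewrite step_cutoffE.
  have Lxy : x - y + 1 <= j.+1%:R by near: j; exact: near_natr_ge.
  have [L LE] : exists L : R, L = j.+1%:R by eexists.
  have L0 : 0 < L by rewrite LE ltr0n.
  have L1 : 1 <= L by rewrite LE ler1n.
  rewrite -LE in Lxy *.
  set s := sin _; have /andP[s0 s1] : -1 <= s <= 1 by rewrite sin_geN1 sin_le1.
  have sle : s <= - (k / L ^+ 2).
    rewrite -[s]opprK lerN2 /s -sinN -mulNr.
    have iL0 : 0 < L^-1 by rewrite invr_gt0.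
    have iL1 : L^-1 <= 1 by rewrite invf_le1.
    have t0 : 0 <= - (y - x - L^-1) / L <= 1.
      apply/andP; split; first by apply: mulr_ge0; [lra|exact: ltW].
      by rewrite ler_pdivrMr// mul1r; lra.
    apply: le_trans (sin_ge_linear t0); rewrite -/k; apply: (ler_wpM2l (ltW k0)).
    by rewrite expr2 invfM; apply: (ler_wpM2r (ltW iL0)); lra.
  apply/andP; split; last first.
    have u0 : 0 <= (1 + s) / 2 by lra.
    rewrite exprn_ile1// ?subr_ge0 ?exprn_ile1//; try lra.
    by rewrite lerBlDr lerDl exprn_ge0.
  apply: le_trans (cutoff_core_lo _ _); last by rewrite s0.
  rewrite lerD2l lerN2 (@le_trans _ _ (expR (- (k * L))))//.
    rewrite ler_expR natrX -LE; apply: le_trans (ler_wpM2l _ sle) _.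
      by rewrite exprn_ge0// ltW.
    rewrite mulrN lerN2 (_ : L ^+ 4 * _ = k * L * L) ?ler_peMr ?mulr_ge0 ?(ltW k0) ?(ltW L0)//.
    by field; rewrite gt_eqF.
  rewrite expRN lef_pV2 ?posrE ?expR_gt0 ?mulr_gt0//.
  by apply: le_trans (expR_ge1Dx _); rewrite lerDr.
rewrite memNset; last by rewrite /= in_itv/= leNgt xy.
set c := k * ((y - x) / 2); have c0 : 0 < c by rewrite mulr_gt0// divr_gt0// subr_gt0.
apply: (squeeze_cvgr _ (cvg_cst _) (cvg_invn c)).
near=> j; have /andP[h0 _] := cutoff_ge0_le1 (j.+1%:R^-1)
  (- ((x + j.+1%:R^-1) / j.+1%:R) - pi / 2) (j.+1 ^ 4) (2 ^ (j.+1 ^ 4)) y.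
apply/andP; split; first exact: h0.
have Lxy : y - x <= j.+1%:R by near: j; exact: near_natr_ge.
(* From here on the shift [1/L] takes away at most half of [y - x]. *)
have L2' : ((y - x) / 2)^-1 <= j.+1%:R by near: j; exact: near_natr_ge.
have [L LE] : exists L : R, L = j.+1%:R by eexists.
have L0 : 0 < L by rewrite LE ltr0n.
have L1 : 1 <= L by rewrite LE ler1n.
rewrite step_cutoffE; rewrite -LE in Lxy L2' *.
have L2 : L^-1 <= (y - x) / 2.
  by rewrite invf_ple ?posrE ?divr_gt0 ?subr_gt0.
set s := sin _; have /andP[s0 s1] : -1 <= s <= 1 by rewrite sin_geN1 sin_le1.
have iL0 : 0 < L^-1 by rewrite invr_gt0.
have sge : c / L <= s.
  have t0 : 0 <= (y - x - L^-1) / L <= 1.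
    apply/andP; split; first by apply: mulr_ge0; [lra|exact: ltW].
    by rewrite ler_pdivrMr// mul1r; lra.
  apply: le_trans (sin_ge_linear t0); rewrite -/k /c -mulrA; apply: (ler_wpM2l (ltW k0)).
  by apply: (ler_wpM2r (ltW iL0)); lra.
have sp : 0 <= s by rewrite (le_trans _ sge)// divr_ge0 ?ltW.
apply: le_trans (cutoff_core_hi _ _) _; first by rewrite sp.
rewrite expRN lef_pV2 ?posrE ?expR_gt0 ?mulr_gt0//.
apply: le_trans (expR_ge1Dx _); rewrite natrX -LE.
apply: (@le_trans _ _ (L ^+ 4 * s)); last by rewrite lerDr.
apply: le_trans (ler_wpM2l _ sge); last by rewrite exprn_ge0// ltW.
rewrite (_ : L ^+ 4 * (c / L) = c * L * (L * L)).
  apply: ler_peMr; first exact: mulr_ge0 (ltW c0) (ltW L0).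
  by rewrite (le_trans L1)// ler_peMr// ltW.
by field; rewrite gt_eqF.
by rewrite subr_gt0.
Unshelve. all: by end_near. Qed.

End cutoff_limit.

Lemma eq_cdf_distribution (R : realType)
    d (T : measurableType d) (P : probability T R)
    d' (T' : measurableType d') (P' : probability T' R)
    (Y : {RV P >-> R}) (Y' : {RV P' >-> R}) :
  cdf Y =1 cdf Y' ->
  forall A : set R, measurable A -> distribution P Y A = distribution P' Y' A.
Proof.
move=> YY'; apply: (@measure_unique _ R _ (@RGenOInfty.G R)
  (fun k => `]- k%:R, +oo[%classic)).
- exact: RGenOInfty.measurableE.
- move=> _ _ [x ->] [y ->]; exists (Num.max x y).
  by apply/seteqP; split => z; rewrite /= !in_itv/= !andbT gt_max => /andP.
- by move=> k; exists (- k%:R).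
- apply/seteqP; split => // z _; exists (Num.truncn `|z|).+1 => //=.
  by rewrite in_itv/= andbT ltrNl (le_lt_trans _ (truncnS_gt _))// ler_normr lexx orbT.
- move=> _ [x ->]; rewrite -setCitvl.
  have E d0 (T0 : measurableType d0) (P0 : probability T0 R) (Y0 : {RV P0 >-> R}) :
    distribution P0 Y0 (~` `]-oo, x]) = (1 - cdf Y0 x)%E.
    exact: probability_setC.
  by apply: etrans (E _ _ _ _) (etrans _ (esym (E _ _ _ _))); rewrite YY'.
- by move=> k; rewrite (le_lt_trans (probability_le1 _ _))// ltry.
Qed.

Lemma measurable_cutoff (R : realType) (s psi : R) n m :
  measurable_fun setT (cutoff s psi n m).
Proof.
apply: measurable_funX; apply: measurable_funB => //.
apply: measurable_funX; apply: measurable_funM => //.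
by apply: measurable_funD => //; exact: measurable_cos_shift.
Qed.

Lemma cvg_integral_step_cutoff (R : realType) d0 (T0 : measurableType d0)
    (P0 : probability T0 R) (Y0 : {RV P0 >-> R}) x :
  (\int[P0]_w step_cutoff x j (Y0 w) @[j --> \oo] --> fine (cdf Y0 x))%R.
Proof.
have mA : measurable (Y0 @^-1` `]-oo, x]).
  by rewrite -[_ @^-1` _]setTI; exact: measurable_funP.
have mY0 : measurable_fun setT Y0 by exact: measurable_funPT.
have -> : cdf Y0 x = (\int[P0]_w (\1_`]-oo, x] (Y0 w))%:E)%E.
  by apply: esym; apply: etrans (integral_indic P0 measurableT mA) _; rewrite setIT.
have i1 : P0.-integrable setT (fun w => (\1_`]-oo, x] (Y0 w))%:E).
  exact: (integrable_indic P0 mA).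
apply: fine_cvg; rewrite fineK; last exact: integrable_fin_num.
case: (@dominated_convergence _ _ _ P0 setT measurableT
  (fun j w => (step_cutoff x j (Y0 w))%:E) (fun w => (\1_`]-oo, x] (Y0 w))%:E)
  (cst 1%E)) => //.
- by move=> j; apply/measurable_EFinP; exact: (measurableT_comp (measurable_cutoff _ _ _ _)).
- exact: measurable_int i1.
- by apply/aeW => w _; apply: cvg_EFin; [exact: nearW|exact: cvg_step_cutoff].
- exact: finite_measure_integrable_cst.
- apply/aeW => w j _; have /andP[h0 h1] := cutoff_ge0_le1 (j.+1%:R^-1)
    (- ((x + j.+1%:R^-1) / j.+1%:R) - pi / 2) (j.+1 ^ 4) (2 ^ (j.+1 ^ 4)) (Y0 w).
  by rewrite /= lee_fin ger0_norm.
Qed.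

Section moments_determine_law.
Context (R : realType).
Context d (T : measurableType d) (P : probability T R)
  d' (T' : measurableType d') (P' : probability T' R).
Variables (Y : {RV P >-> R}) (Y' : {RV P' >-> R}) (K K' : R -> R).
Hypotheses (YK : exp_moments_le P Y K) (YK' : exp_moments_le P' Y' K').
Hypothesis eq_moments :
  forall k, \int[P]_w (Y w ^+ k) = \int[P']_w (Y' w ^+ k).

Lemma eq_moments_cdf : cdf Y =1 cdf Y'.
Proof.
move=> x; have h := @cvg_integral_step_cutoff _ _ _ _ Y x.
have h' := @cvg_integral_step_cutoff _ _ _ _ Y' x.
suff E : fine (cdf Y x) = fine (cdf Y' x).
  by rewrite -[LHS]fineK ?E ?fineK// fin_num_measure.
apply: cvg_unique h _ => //.
rewrite (_ : (fun j => _) = fun j => (\int[P']_w step_cutoff x j (Y' w))%R)//.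
by apply/funext => j; exact: (Rintegral_cutoff YK YK' eq_moments).
Qed.

End moments_determine_law.

(** * Convergence in distribution along a filter *)

Section real_cdf.
Context (R : realType) d (T : measurableType d) (P : probability T R).
Variable Y : {RV P >-> R}.

Definition rcdf (x : R) : R := fine (cdf Y x).

Lemma rcdfE x : cdf Y x = (rcdf x)%:E.
Proof. by rewrite /rcdf fineK// fin_num_measure. Qed.

Lemma rcdf_nondecreasing : {homo rcdf : x y / x <= y}.
Proof. by move=> x y xy; rewrite -lee_fin -!rcdfE cdf_nondecreasing. Qed.

Lemma rcdf_ge0_le1 x : 0 <= rcdf x <= 1.
Proof. by rewrite -!lee_fin -rcdfE cdf_ge0 cdf_le1. Qed.

Lemma measurable_preimage_itv (i : interval R) : measurable (Y @^-1` [set` i]).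
Proof.
by rewrite -[_ @^-1` _]setTI; apply: measurable_funP => //; exact: measurable_itv.
Qed.

Lemma probability_itv_oc a b : a <= b ->
  P (Y @^-1` `]a, b]) = (rcdf b - rcdf a)%:E.
Proof.
move=> ab; rewrite EFinB -!rcdfE /cdf /distribution /pushforward.
have -> : Y @^-1` `]a, b] = Y @^-1` `]-oo, b] `\` Y @^-1` `]-oo, a].
  apply/seteqP; split => w; rewrite /= !in_itv/=.
    by move=> /andP[aw wb]; split => //; rewrite leNgt aw.
  by move=> [wb /negP]; rewrite -ltNge => ->.
rewrite measureD ?setIidr//; try exact: measurable_preimage_itv.
  by move=> w /=; rewrite !in_itv/= => /le_trans; exact.
by rewrite (le_lt_trans (probability_le1 _ _)) ?ltry//; exact: measurable_preimage_itv.
Qed.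

(** Only left continuity is at stake: without an atom the value at [x] is [P (Y < x)], which
    continuity from below makes the limit of the values at [x - 1/(n+1)]; monotonicity covers the
    points in between. *)
Lemma continuous_cdf_no_atom x : pmf Y x = 0 -> {for x, continuous (cdf Y)}.
Proof.
move=> Yx; apply/left_right_continuousP; split; last exact: cdf_right_continuous.
rewrite (_ : cdf Y = EFin \o rcdf); last by apply/funext => y; rewrite /= -rcdfE.
apply: cvg_EFin; first exact: nearW.
pose F n := Y @^-1` `]-oo, x - n.+1%:R^-1].
have UF : \bigcup_n F n = Y @^-1` `]-oo, x[.
  apply/seteqP; split => [w [n _]|w].
    by rewrite /F /= !in_itv/= => /le_lt_trans; apply; rewrite ltrBlDr ltrDl.
  rewrite /= in_itv/= => /ltr_add_invr[n nx]; exists n => //.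
  by rewrite /F /= in_itv/= lerBrDr ltW.
have PYx : P (Y @^-1` `]-oo, x[) = cdf Y x.
  rewrite /cdf /distribution /pushforward/=.
  have -> : `]-oo, x]%classic = `]-oo, x[ `|` [set x] by rewrite setUitv1.
  rewrite preimage_setU measureU//.
  - rewrite [X in (_ + X)%E](_ : _ = 0%E) ?adde0//.
    by rewrite -[LHS]fineK ?fin_num_measure// -/(pmf Y x) Yx.
  - exact: measurable_preimage_itv.
  - apply/seteqP; split => // w /= []; rewrite in_itv/= => /[swap] ->.
    by rewrite ltxx.
have Fcvg : rcdf (x - n.+1%:R^-1) @[n --> \oo] --> rcdf x.
  apply: fine_cvg; rewrite -rcdfE -PYx -UF; apply: (@nondecreasing_cvg_mu _ _ _ P F).
  - by move=> n; exact: measurable_preimage_itv.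
  - by rewrite UF; exact: measurable_preimage_itv.
  - move=> m n mn; apply/subsetPset => w; rewrite /F/= !in_itv/= => /le_trans; apply.
    by rewrite lerB// lef_pV2 ?posrE// ler_nat.
apply/cvgrPdist_le => e e0; have /cvgrPdist_le/(_ e e0)[n _ /(_ n (leqnn n)) Fn] := Fcvg.
near=> y; have yx : y < x by near: y; exact: nbhs_left_lt.
have xy : x - n.+1%:R^-1 <= y.
  by near: y; apply: nbhs_left_ge; rewrite ltrBlDr ltrDl.
move: Fn; rewrite !ger0_norm ?subr_ge0 ?rcdf_nondecreasing ?(ltW yx)//.
  by apply: le_trans; rewrite lerD2l lerN2 rcdf_nondecreasing.
by rewrite lerBlDr lerDl.
Unshelve. all: by end_near. Qed.

(** The atoms form a countable, hence Lebesgue-null, set, which cannot contain an interval of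
    positive length. *)
Lemma exists_no_atom a b : a < b -> exists x, a < x < b /\ pmf Y x = 0.
Proof.
move=> ab; apply: contrapT => h.
have : (lebesgue_measure `]a, b[ <= lebesgue_measure [set r | 0 < pmf Y r]%R)%E.
  apply: le_measure; rewrite ?inE//.
    exact/countable_measurable/pmf_gt0_countable.
  move=> x /=; rewrite in_itv/= => axb; rewrite lt_neqAle pmf_ge0 andbT.
  by apply/eqP => p0; apply: h; exists x.
rewrite (countable_lebesgue_measure0 (pmf_gt0_countable Y)).
by rewrite lebesgue_measure_itv/= lte_fin ab -EFinB lee_fin subr_le0 leNgt ab.
Qed.

End real_cdf.

(** * Expectations truncated to a bounded interval *)

Section truncated_expectation.
Context (R : realType) d (T : measurableType d) (P : probability T R).
Variables (Y : {RV P >-> R}) (g : R -> R) (C t : R).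
Hypotheses (mg : measurable_fun setT g).
Hypothesis gC : forall y, `|g y| <= C * expR (t * `|y|).

(** Half-open intervals tile without overlap, and their masses are differences of the distribution
    function. *)
Definition trunc_exp a b : R := \int[P]_(w in Y @^-1` `]a, b]) g (Y w).

(** Boundedness of [g] on []a, b]] is enough, so this applies to a limit law before its exponential
    moments are known. *)
Lemma integrable_trunc a b :
  P.-integrable (Y @^-1` `]a, b]) (fun w => (g (Y w))%:E).
Proof.
have mA : measurable (Y @^-1` `]a, b]) by exact: measurable_preimage_itv.
have mY : measurable_fun setT Y by exact: measurable_funPT.
apply: measurable_bounded_integrable => //.
- by rewrite (le_lt_trans (probability_le1 _ _)) ?ltry.
- by apply: measurable_funTS; exact: measurableT_comp.
- exists (C * expR (`|t| * (`|a| + `|b|))); split; first exact: num_real.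
  move=> M CM w /=; rewrite in_itv/= => /andP[aw wb]; rewrite ltW// (le_lt_trans _ CM)//.
  have C0 : 0 <= C.
    by have := le_trans (normr_ge0 _) (gC 0); rewrite pmulr_lge0 ?expR_gt0.
  apply: le_trans (gC _) _; rewrite ler_wpM2l// ler_expR.
  apply: le_trans (_ : `|t| * `|Y w| <= _); first by rewrite ler_wpM2r// ler_norm.
  rewrite ler_wpM2l// ler_norml; apply/andP; split.
    rewrite lerNl (le_trans _ (_ : `|a| <= _)) ?lerDl//.
    by rewrite (le_trans (_ : _ <= - a)) ?lerN2 ?(ltW aw)// -normrN ler_norm.
  by rewrite (le_trans wb)// (le_trans (ler_norm b))// lerDr.
Qed.

Lemma trunc_expD a b c : a <= b -> b <= c ->
  trunc_exp a c = trunc_exp a b + trunc_exp b c.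
Proof.
move=> ab bc; rewrite /trunc_exp -Rintegral_setU.
- congr (Rintegral _ _ _); rewrite -preimage_setU; congr (_ @^-1` _).
  apply/seteqP; split => y /=; rewrite !in_itv/=.
    by move=> /andP[ay yc]; have [yb|by_] := leP y b; [left|right]; rewrite ?ay ?yb ?by_.
  move=> [/andP[ay yb]|/andP[by_ yc]]; first by rewrite ay (le_trans yb).
  by rewrite yc (le_lt_trans ab).
- exact: measurable_preimage_itv.
- exact: measurable_preimage_itv.
- apply: (@integrableS _ _ _ _ (Y @^-1` `]a, c])).
  + exact: measurable_preimage_itv.
  + by apply: measurableU; exact: measurable_preimage_itv.
  + move=> y /= [] /=; rewrite !in_itv/=.
      by move=> /andP[ay yb]; rewrite ay (le_trans yb).
    by move=> /andP[by_ yc]; rewrite yc (le_lt_trans ab).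
  + exact: integrable_trunc.
- apply/disj_setPS => y [/=]; rewrite !in_itv/= => /andP[_ yb] /andP[by_ _].
  by rewrite leNgt by_ in yb.
Qed.

Lemma trunc_exp_osc a b c e : a <= b -> (forall y, a < y <= b -> `|g y - c| <= e) ->
  `|trunc_exp a b - c * (rcdf Y b - rcdf Y a)| <= e * (rcdf Y b - rcdf Y a).
Proof.
move=> ab ge; have mA : measurable (Y @^-1` `]a, b]) by exact: measurable_preimage_itv.
have cE (k : R) : \int[P]_(w in Y @^-1` `]a, b]) k = k * (rcdf Y b - rcdf Y a).
  by rewrite Rintegral_cst//; have /(congr1 fine)/= <- := probability_itv_oc Y ab.
have ic (k : R) : P.-integrable (Y @^-1` `]a, b]) (fun w => k%:E).
  apply: (@integrableS _ _ _ _ setT) => //; exact: finite_measure_integrable_cst.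
rewrite -!cE /trunc_exp -(RintegralB mA (integrable_trunc a b) (ic c)).
have iB : P.-integrable (Y @^-1` `]a, b]) (fun w => (g (Y w) - c)%:E).
  exact: (integrableB mA (integrable_trunc a b) (ic c)).
apply: le_trans (le_normr_Rintegral mA iB) _.
apply: le_Rintegral => //.
- exact: (integrable_norm iB).
- exact: ic.
- by move=> w /=; rewrite in_itv/= => /ge.
Qed.

End truncated_expectation.

(** A regularity shared by powers and by [e^(t|y|)], which has a kink at 0. The constant is positive
    so that a mesh [e / L] can be formed. *)
Definition locally_lipschitz (R : realType) (g : R -> R) : Prop :=
  forall M, exists2 L, 0 < L &
    forall x y, `|x| <= M -> `|y| <= M -> `|g x - g y| <= L * `|x - y|.

Lemma locally_lipschitz_exprn (R : realType) k :
  locally_lipschitz (fun y : R => y ^+ k).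
Proof.
move=> M; have [M0|M0] := ltP M 0.
  by exists 1 => // x y xM; have := le_trans (normr_ge0 x) xM; rewrite leNgt M0.
elim: k => [|k [L L0 IH]].
  by exists 1 => // x y _ _; rewrite !expr0 subrr normr0 mul1r.
exists (M ^+ k + M * L + 1) => [|x y xM yM].
  by rewrite ltr_wpDl// addr_ge0 ?exprn_ge0// mulr_ge0// ltW.
rewrite !exprS (_ : _ - _ = (x - y) * x ^+ k + y * (x ^+ k - y ^+ k)); last by ring.
apply: le_trans (ler_normD _ _) _; rewrite !normrM !mulrDl.
rewrite -addrA lerD//; first by rewrite mulrC ler_wpM2r// normrX lerXn2r ?nnegrE.
rewrite ler_wpDr ?mul1r// -mulrA ler_pM//; exact: IH.
Qed.

Lemma locally_lipschitz_exp_abs (R : realType) (t : R) :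
  locally_lipschitz (fun y : R => expR (t * `|y|)).
Proof.
move=> M; exists (`|t| * expR (`|t| * M) + 1) => [|x y xM yM].
  by rewrite ltr_wpDl// mulr_ge0// expR_ge0.
wlog xy : x y xM yM / expR (t * `|y|) <= expR (t * `|x|) => [hw|].
  have [xy|/ltW yx] := leP (expR (t * `|y|)) (expR (t * `|x|)); first exact: hw.
  by rewrite distrC [`|x - y|]distrC hw.
rewrite ger0_norm ?subr_ge0//.
rewrite -[expR (t * `|y|)]mul1r -[t * `|x|](subrK (t * `|y|)) expRD -mulrBl.
set u := t * _ - _.
apply: le_trans (ler_wpM2r (expR_ge0 _) (expR_sub1_le u)) _.
rewrite -mulrA -expRD {2}/u subrK.
have tx : t * `|x| <= `|t| * M.
  by apply: (@le_trans _ _ (`|t| * `|x|)); [rewrite ler_wpM2r// ler_norm|rewrite ler_wpM2l].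
have uxy : u <= `|t| * `|x - y|.
  rewrite /u -mulrBr; apply: le_trans (ler_norm _) _.
  by rewrite normrM ler_wpM2l// ler_dist_dist.
apply: (@le_trans _ _ (`|t| * `|x - y| * expR (`|t| * M))).
  apply: (@le_trans _ _ (`|t| * `|x - y| * expR (t * `|x|))).
    by rewrite ler_wpM2r ?expR_ge0.
  by rewrite ler_wpM2l ?mulr_ge0// ler_expR.
by rewrite mulrDl mul1r ler_wpDr// mulrAC.
Qed.

(** * Passing expectations to the limit *)

Section filter_convergence.
Context (R : realType).
Context (d : nat -> measure_display) (T : forall N, measurableType (d N))
    (P : forall N, probability (T N) R) (X : forall N, {RV (P N) >-> R}).
Context d' (T' : measurableType d') (P' : probability T' R) (Y : {RV P' >-> R}).
Context (G : set_system nat) {FG : ProperFilter G}.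
Hypothesis XY : forall x, pmf Y x = 0 -> rcdf (X N) x @[N --> G] --> rcdf Y x.

Section test_function.
Variables (g : R -> R) (C t : R).
Hypotheses (mg : measurable_fun setT g) (glip : locally_lipschitz g).
Hypothesis gC : forall y, `|g y| <= C * expR (t * `|y|).

(* Riemann-sum comparison, by induction on the number of steps of length at least
   [dlt / 2]: a division point of an interval is only available up to a small
   shift, since it must not be an atom of the limit law. *)
Lemma trunc_exp_near a b e : a < b -> pmf Y a = 0 -> pmf Y b = 0 -> 0 < e ->
  forall eta, 0 < eta -> \forall N \near G,
    `|trunc_exp (X N) g a b - trunc_exp Y g a b| <=
    e * ((rcdf (X N) b - rcdf (X N) a) + (rcdf Y b - rcdf Y a)) + eta.
Proof.
move=> ab Ya Yb e0; have [L L0 Lg] := glip (`|a| + `|b|).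
(* On a piece of length at most [dlt], [g] stays within [e] of its value at the right end. *)
pose dlt := e / L; have dlt0 : 0 < dlt by rewrite divr_gt0.
have small u v : a <= u -> u <= v -> v <= b -> v - u <= dlt ->
    pmf Y u = 0 -> pmf Y v = 0 ->
    forall eta, 0 < eta -> \forall N \near G,
    `|trunc_exp (X N) g u v - trunc_exp Y g u v| <=
    e * ((rcdf (X N) v - rcdf (X N) u) + (rcdf Y v - rcdf Y u)) + eta.
  move=> au uv vb vu Yu Yv eta eta0.
  have osc y : u < y <= v -> `|g y - g v| <= e.
    move=> /andP[uy yv].
    have nM z : a <= z -> z <= b -> `|z| <= `|a| + `|b|.
      move=> az zb; rewrite ler_norml; apply/andP; split.
        by rewrite lerNl (le_trans (_ : _ <= - a)) ?lerN2// -normrN ler_wpDr// ler_norm.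
      by rewrite (le_trans zb)// ler_wpDl// ler_norm.
    apply: le_trans (Lg _ _ (nM _ _ _) (nM _ _ _)) _; rewrite ?(le_trans yv)//.
    - by rewrite (le_trans au)// ltW.
    - by rewrite (le_trans au).
    rewrite -ler_pdivlMl// mulrC -/dlt ler0_norm ?subr_le0// opprB.
    by rewrite (le_trans _ vu)// lerD2l lerN2 ltW.
  have cvgc : g v * (rcdf (X N) v - rcdf (X N) u) @[N --> G] -->
      g v * (rcdf Y v - rcdf Y u).
    by apply: cvgMr; apply: cvgB; exact: XY.
  have /cvgrPdist_le/(_ eta eta0) := cvgc; apply: filterS => N hN.
  have h1 := trunc_exp_osc (X N) mg gC uv osc.
  have h2 := trunc_exp_osc Y mg gC uv osc.
  move: hN h1 h2; rewrite !ler_norml => /andP[? ?] /andP[? ?] /andP[? ?].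
  by apply/andP; split; lra.
have main n : forall v, a < v -> v <= b -> v - a <= n%:R * (dlt / 2) -> pmf Y v = 0 ->
    forall eta, 0 < eta -> \forall N \near G,
    `|trunc_exp (X N) g a v - trunc_exp Y g a v| <=
    e * ((rcdf (X N) v - rcdf (X N) a) + (rcdf Y v - rcdf Y a)) + eta.
  elim: n => [|n IH] v av vb; first by rewrite mul0r subr_le0 leNgt av.
  move=> va Yv eta eta0.
  have [va'|nva] := leP (v - a) dlt; first exact: small (ltW av) vb va' Ya Yv _ eta0.
  rewrite -natr1 mulrDl mul1r in va.
  have [u /andP[u1 u2] Yu] : exists2 u, v - dlt < u < v - dlt / 2 & pmf Y u = 0.
    by have [|u [? ?]] := @exists_no_atom _ _ _ _ Y (v - dlt) (v - dlt / 2);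
      [lra|exists u].
  have au : a < u by lra.
  have uv : u <= v by lra.
  (* The masses in the bound add up exactly over adjacent pieces; only the slack [eta] has to be
     shared. *)
  have eta2 : 0 < eta / 2 by rewrite divr_gt0.
  have ua : u - a <= n%:R * (dlt / 2) by lra.
  have vu : v - u <= dlt by lra.
  have h1 := IH u au (le_trans uv vb) ua Yu _ eta2.
  have h2 := small u v (ltW au) uv vb vu Yu Yv _ eta2.
  apply: filterS2 h1 h2 => N h1 h2.
  rewrite (trunc_expD (X N) mg gC (ltW au) uv) (trunc_expD Y mg gC (ltW au) uv).
  by move: h1 h2; rewrite !ler_norml => /andP[? ?] /andP[? ?]; apply/andP; split; lra.
move=> eta eta0; pose n := (Num.truncn ((b - a) / (dlt / 2))).+1.
apply: (main n) => //; rewrite -ler_pdivrMr ?divr_gt0// ltW// /n.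
exact: truncnS_gt.
Qed.

Lemma cvg_trunc_exp a b : a < b -> pmf Y a = 0 -> pmf Y b = 0 ->
  trunc_exp (X N) g a b @[N --> G] --> trunc_exp Y g a b.
Proof.
move=> ab Ya Yb; apply/cvgrPdist_le => e e0.
have e4 : 0 < e / 4 by rewrite divr_gt0.
apply: filterS (trunc_exp_near ab Ya Yb e4 e4) => N.
have /andP[? ?] := rcdf_ge0_le1 (X N) a; have /andP[? ?] := rcdf_ge0_le1 (X N) b.
have /andP[? ?] := rcdf_ge0_le1 Y a; have /andP[? ?] := rcdf_ge0_le1 Y b.
by rewrite distrC => /le_trans; apply; nra.
Qed.

End test_function.

Variable K : R -> R.
Hypothesis XK : forall N, exp_moments_le (P N) (X N) K.

Lemma measurable_locally_lipschitz (g : R -> R) :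
  locally_lipschitz g -> measurable_fun setT g.
Proof.
move=> glip; apply: continuous_measurable_fun => x.
have [L L0 Lg] := glip (`|x| + 1).
apply/cvgrPdist_le => e e0; near=> y.
have xy1 : `|x - y| <= 1 by near: y; apply: cvgr_dist_le => //; exact: cvg_id.
have xy2 : `|x - y| <= e / L.
  by near: y; apply: cvgr_dist_le; [exact: cvg_id|rewrite divr_gt0].
apply: le_trans (Lg _ _ _ _) _; first by rewrite lerDl.
  rewrite -[y](subrK x) addrC (le_trans (ler_normD _ _))// lerD2l.
  by rewrite distrC.
by rewrite -ler_pdivlMl// mulrC.
Unshelve. all: by end_near. Qed.

(** A Fatou argument: between two points without atoms the truncated expectation of [Y] is a limit
    of truncated expectations of [X N], each at most [K t] because the integrand is positive. Such
    points exist just outside [[-n, n]], and monotone convergence removes the truncation. *)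
Lemma exp_moments_le_limit : exp_moments_le P' Y K.
Proof.
move=> t; pose g (y : R) : R := expR (t * `|y|).
have mg : measurable_fun setT g := measurable_exp_abs t.
have glip : locally_lipschitz g := locally_lipschitz_exp_abs t.
have gC y : `|g y| <= 1 * expR (t * `|y|) by rewrite mul1r ger0_norm// expR_ge0.
have choice n : exists ab : R * R, [/\ ab.1 < - n%:R, n%:R <= ab.2, ab.1 < ab.2,
    pmf Y ab.1 = 0 & pmf Y ab.2 = 0].
  have [|a [/andP[a1 a2] Ya]] := @exists_no_atom _ _ _ _ Y (- n%:R - 1) (- n%:R).
    by lra.
  have [|b [/andP[b1 b2] Yb]] := @exists_no_atom _ _ _ _ Y n%:R (n%:R + 1).
    by lra.
  exists (a, b); split => //=; try lra.
  by have := ler0n R n; lra.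
pose F (n : nat) := Y @^-1` `[- n%:R, n%:R].
have mF n : measurable (F n) by exact: measurable_preimage_itv.
have bound n : (\int[P']_(w in F n) (g (Y w))%:E <= (K t)%:E)%E.
  have [[a b] /= [a1 b1 ab Ya Yb]] := choice n.
  have h := cvg_trunc_exp mg glip gC ab Ya Yb.
  have le1 : trunc_exp Y g a b <= K t.
    apply: cvgr_to_le h _; apply: nearW => N.
    apply: le_trans (Rintegral_exp_abs_le (XK N) t).
    rewrite /trunc_exp Rintegral_mkcond; apply: le_Rintegral => //.
    - rewrite -restrict_EFin -integrable_mkcond; last exact: measurable_preimage_itv.
      exact: (integrable_trunc (X N) mg gC).
    - exact: (integrable_exp_abs (XK N)).
    - by move=> w _; rewrite patchE; case: ifP => _ //; rewrite expR_ge0.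
  apply: (@le_trans _ _ (\int[P']_(w in Y @^-1` `]a, b]) (g (Y w))%:E)%E).
    apply: ge0_subset_integral => //; try exact: measurable_preimage_itv.
    - by apply/measurable_EFinP; apply: measurable_funTS; exact: measurableT_comp.
    - by move=> w _; rewrite lee_fin expR_ge0.
    - move=> w; rewrite /F/= !in_itv/= => /andP[w1 w2].
      by rewrite (lt_le_trans a1)// (le_trans w2).
  rewrite -[leLHS]fineK ?lee_fin//; apply: integrable_fin_num.
    exact: measurable_preimage_itv.
  exact: (integrable_trunc Y mg gC).
have mgY : measurable_fun setT (fun w => (g (Y w))%:E).
  by apply/measurable_EFinP; exact: measurableT_comp.
have UF : \bigcup_n F n = setT.
  apply/seteqP; split => // w _; exists (Num.truncn `|Y w|).+1 => //.
  by rewrite /F/= in_itv/= -ler_norml ltW// truncnS_gt.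
have int_cvg : (\int[P']_(w in F n) (g (Y w))%:E @[n --> \oo] -->
    \int[P']_w (g (Y w))%:E)%E.
  rewrite -UF; apply: ge0_nondecreasing_set_cvg_integral => //.
  - move=> m n mn; apply/subsetPset => w; rewrite /F/= !in_itv/= => /andP[h1 h2].
    rewrite (le_trans h2) ?ler_nat// andbT (le_trans _ h1)// lerN2 ler_nat//.
  - by move=> n; exact: measurable_funTS.
  - by move=> n w _; rewrite lee_fin expR_ge0.
rewrite -(cvg_lim _ int_cvg)//; apply: lime_le; last exact: nearW.
by apply/cvg_ex; eexists; exact: int_cvg.
Qed.

(** Off []a, b]] one has [|y| >= M], so [e^(t|y|)] is at most [e^{-M}] times [e^((t+1)|y|)]: uniform
    integrability, paid for by one unit of the exponent. *)
Lemma normr_Rintegral_sub_trunc_le d0 (T0 : measurableType d0)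
    (P0 : probability T0 R) (Z : {RV P0 >-> R}) (g : R -> R) C t a b M :
  exp_moments_le P0 Z K -> measurable_fun setT g ->
  (forall y, `|g y| <= C * expR (t * `|y|)) -> a <= - M -> M <= b ->
  `|\int[P0]_w g (Z w) - trunc_exp Z g a b| <= C * expR (- M) * K (t + 1).
Proof.
move=> ZK mg gC aM Mb.
have mA : measurable (Z @^-1` `]a, b]) by exact: measurable_preimage_itv.
pose h y : R := g y * \1_(~` `]a, b]) y.
have mh : measurable_fun setT h.
  apply: measurable_funM => //; apply: measurable_indic.
  by apply: measurableC; exact: measurable_itv.
have C0 : 0 <= C.
  by have := le_trans (normr_ge0 _) (gC 0); rewrite pmulr_lge0 ?expR_gt0.
have hC y : `|h y| <= C * expR (- M) * expR ((t + 1) * `|y|).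
  rewrite normrM indicE; have [yab|yab] := boolP (y \in ~` `]a, b]); last first.
    by rewrite normr0 mulr0 !mulr_ge0 ?expR_ge0.
  rewrite normr1 mulr1 -mulrA -expRD (le_trans (gC y))// ler_wpM2l// ler_expR.
  rewrite mulrDl mul1r addrCA lerDl addrC subr_ge0.
  move: yab; rewrite inE/= in_itv/= => /negP; rewrite negb_and -leNgt -ltNge.
  case/orP => [ya|yb].
    have My : M <= - y by rewrite lerNr (le_trans ya).
    by apply: le_trans My _; rewrite -normrN ler_norm.
  by rewrite (le_trans Mb)// (le_trans (ltW yb))// ler_norm.
rewrite (_ : _ - _ = \int[P0]_w h (Z w)).
  exact: (normr_Rintegral_exp_dominated ZK mh hC).
rewrite [trunc_exp _ _ _ _]Rintegral_mkcond -RintegralB//.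
- apply: eq_Rintegral => w _; rewrite /h patchE indicE.
  have -> : (Z w \in ~` `]a, b]) = ~~ (w \in Z @^-1` `]a, b]).
    by rewrite in_setC; congr (~~ _); apply/idP/idP; rewrite !inE.
  by case: (w \in _); rewrite ?mulr0 ?mulr1 ?subrr ?subr0.
- exact: (integrable_exp_dominated ZK mg gC).
- rewrite -restrict_EFin -integrable_mkcond//.
  exact: (integrable_trunc Z mg gC).
Qed.

Lemma cvg_Rintegral_locally_lipschitz (g : R -> R) (C t : R) :
  locally_lipschitz g -> (forall y, `|g y| <= C * expR (t * `|y|)) ->
  \int[P N]_w g (X N w) @[N --> G] --> \int[P']_w g (Y w).
Proof.
move=> glip gC; have mg := measurable_locally_lipschitz glip.
have YK := exp_moments_le_limit.
have CK0 : 0 <= C * K (t + 1).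
  rewrite mulr_ge0//.
    by have := le_trans (normr_ge0 _) (gC 0); rewrite pmulr_lge0 ?expR_gt0.
  apply: le_trans (Rintegral_exp_abs_le YK (t + 1)).
  by apply: Rintegral_ge0 => w _; exact: expR_ge0.
apply/cvgrPdist_le => e e0.
(* Chosen so that [C * K (t + 1) = e / 3 * M]; with [M <= e^M] the truncation error is at most
   [e / 3], uniformly in [N]. *)
pose M := 3 * (C * K (t + 1)) / e; have M0 : 0 <= M.
  by apply: divr_ge0 (ltW e0); apply: mulr_ge0 => //.
have Me : C * expR (- M) * K (t + 1) <= e / 3.
  rewrite mulrAC expRN ler_pdivrMr ?expR_gt0//.
  apply: (@le_trans _ _ (e / 3 * M)); last first.
    rewrite ler_wpM2l ?divr_ge0 ?(ltW e0)//.
    by apply: le_trans (expR_ge1Dx _); rewrite lerDr.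
  by rewrite /M le_eqVlt; apply/orP; left; apply/eqP; field; rewrite gt_eqF.
have [|a [/andP[a1 a2] Ya]] := @exists_no_atom _ _ _ _ Y (- M - 1) (- M); first by lra.
have [|b [/andP[b1 b2] Yb]] := @exists_no_atom _ _ _ _ Y M (M + 1); first by lra.
have ab : a < b by lra.
have e3 : 0 < e / 3 by rewrite divr_gt0.
have /cvgrPdist_le/(_ _ e3) := cvg_trunc_exp mg glip gC ab Ya Yb.
apply: filterS => N hN.
have h1 := normr_Rintegral_sub_trunc_le (XK N) mg gC (ltW a2) (ltW b1).
have h2 := normr_Rintegral_sub_trunc_le YK mg gC (ltW a2) (ltW b1).
have {h1} := le_trans h1 Me; have {h2} := le_trans h2 Me; move: hN.
by rewrite !ler_norml => /andP[? ?] /andP[? ?] /andP[? ?]; apply/andP; split; lra.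
Qed.

Lemma cvg_Rintegral_power k :
  \int[P N]_w (X N w ^+ k) @[N --> G] --> \int[P']_w (Y w ^+ k).
Proof.
exact: (cvg_Rintegral_locally_lipschitz (@locally_lipschitz_exprn _ k)
  (fun y => normrX_le_expR y k)).
Qed.

End filter_convergence.

(** * Helly selection along an ultrafilter *)

Section law_of_cdf.
Context (R : realType) (F : R -> R).
Hypothesis F_nd : {homo F : x y / x <= y}.
Hypothesis F_rc : right_continuous F.
Hypothesis FNy0 : F @ -oo --> (0 : R).
Hypothesis Fy1 : F @ +oo --> (1 : R).

#[local] HB.instance Definition _ := isCumulative.Build R _ R F F_nd F_rc.
#[local] HB.instance Definition _ := isCumulativeBounded.Build R 0 1 F FNy0 Fy1.

Lemma exists_law_of_cdf :
  exists (P : probability (measurableTypeR R) R) (Y : {RV P >-> R}),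
    forall x, cdf Y x = (F x)%:E.
Proof. by do 2 eexists; move=> x; exact: cdf_lebesgue_stieltjes_id. Qed.

End law_of_cdf.

Section tails.
Context (R : realType) d (T : measurableType d) (P : probability T R).
Variables (Y : {RV P >-> R}) (K : R -> R).
Hypothesis YK : exp_moments_le P Y K.

Lemma rcdf_Rintegral x : rcdf Y x = \int[P]_w \1_`]-oo, x] (Y w).
Proof.
have mA : measurable (Y @^-1` `]-oo, x]) by exact: measurable_preimage_itv.
rewrite /Rintegral; congr fine; apply: esym.
by apply: etrans (integral_indic P measurableT mA) _; rewrite setIT.
Qed.

Lemma integrable_indic_itv x : P.-integrable setT (fun w => (\1_`]-oo, x] (Y w))%:E).
Proof.
exact: (integrable_indic P (measurable_preimage_itv Y `]-oo, x])).
Qed.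

(** Markov's inequality for [e^|Y|]. Since [K] is common to the sequence, the two tail bounds amount
    to tightness. *)
Lemma rcdf_ge_tail x : 1 - rcdf Y x <= expR (- x) * K 1.
Proof.
rewrite rcdf_Rintegral.
have E1 : 1 = \int[P]_w (1 : R).
  by rewrite Rintegral_cst//; have /(congr1 fine)/= -> := probability_setT P;
    rewrite mulr1.
have i1 : P.-integrable setT (fun=> 1%:E : \bar R) by exact: finite_measure_integrable_cst.
rewrite {1}E1 -RintegralB//; last exact: integrable_indic_itv.
have ie := integrable_exp_abs YK 1.
apply: (@le_trans _ _ (\int[P]_w (expR (- x) * expR (1 * `|Y w|)))).
  apply: le_Rintegral => //.
  - exact: (integrableB measurableT i1 (integrable_indic_itv x)).
  - exact: integrable_realZl.
  - move=> w _; rewrite indicE; have [wx|wx] := boolP (Y w \in _).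
      by rewrite subrr mulr_ge0 ?expR_ge0.
    rewrite subr0 -expRD mul1r -[leLHS]expR0 ler_expR addrC subr_ge0.
    move: wx; rewrite notin_setE/= in_itv/= => /negP; rewrite -ltNge => /ltW xw.
    by rewrite (le_trans xw)// ler_norm.
by rewrite RintegralZl// ler_wpM2l ?expR_ge0 ?(Rintegral_exp_abs_le YK).
Qed.

Lemma rcdf_le_tail x : rcdf Y x <= expR x * K 1.
Proof.
rewrite rcdf_Rintegral.
have ie := integrable_exp_abs YK 1.
apply: (@le_trans _ _ (\int[P]_w (expR x * expR (1 * `|Y w|)))).
  apply: le_Rintegral => //.
  - exact: integrable_indic_itv.
  - exact: integrable_realZl.
  - move=> w _; rewrite indicE; have [wx|wx] := boolP (Y w \in _); last first.
      by rewrite mulr_ge0 ?expR_ge0.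
    rewrite -expRD mul1r -[leLHS]expR0 ler_expR -lerBlDl sub0r.
    move: wx; rewrite inE/= in_itv/= => wx.
    by rewrite (le_trans (_ : _ <= - Y w)) ?lerN2// -normrN ler_norm.
by rewrite RintegralZl// ler_wpM2l ?expR_ge0 ?(Rintegral_exp_abs_le YK).
Qed.

Lemma continuous_cdf_rcdf x :
  {for x, continuous (cdf Y)} -> {for x, continuous (rcdf Y)}.
Proof. by rewrite /prop_for /continuous_at rcdfE => h; apply: fine_cvg. Qed.

End tails.

Section Helly.
Context (R : realType).
Context (d : nat -> measure_display) (T : forall N, measurableType (d N))
    (P : forall N, probability (T N) R) (X : forall N, {RV (P N) >-> R}).
Variable K : R -> R.
Hypothesis XK : forall N, exp_moments_le (P N) (X N) K.
Variables (U : set_system nat) (UU : UltraFilter U).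

(** Compactness of [[a, b]] provides a cluster point; an ultrafilter decides every neighbourhood, so
    a cluster point is a limit. *)
Lemma ultra_bounded_cvg (u : nat -> R) a b :
  (forall n, a <= u n <= b) -> exists l : R, u @ U --> l.
Proof.
move=> uab; have uU : U (u @^-1` `[a, b]).
  by apply: filterE => n; rewrite /= in_itv/= uab.
have [l [_ ul]] := @segment_compact R a b (u @ U) _ uU.
exists l => V Vl; have [//|UV] := in_ultra_setVsetC (u @^-1` V) UU.
by have [y [nVy Vy]] := ul (~` V) V UV Vl.
Qed.

(** The pointwise limit [G] is monotone with the same tail bounds but need not be right continuous;
    [F x], the infimum of [G] over []x, +oo[], repairs this. From [G x <= F x], and [F x <= G y] for
    [x < y], follow monotonicity, the limits at infinity and agreement with [G] where [F] is
    continuous. *)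
Theorem Helly_selection : exists (P' : probability (measurableTypeR R) R)
    (Y : {RV P' >-> R}), forall x : R, {for x, continuous (cdf Y)} ->
  cdf (X N) x @[N --> U] --> cdf Y x.
Proof.
have /choice[G XG] : forall x, exists l : R, rcdf (X N) x @[N --> U] --> l.
  by move=> x; apply: ultra_bounded_cvg => N; exact: rcdf_ge0_le1.
have G01 x : 0 <= G x <= 1.
  apply/andP; split.
    by apply: cvgr_to_ge (XG x) _; apply: nearW => N; have /andP[] := rcdf_ge0_le1 (X N) x.
  by apply: cvgr_to_le (XG x) _; apply: nearW => N; have /andP[] := rcdf_ge0_le1 (X N) x.
have G_nd x y : x <= y -> G x <= G y.
  move=> xy; rewrite -subr_ge0; apply: cvgr_to_ge (cvgB (XG y) (XG x)) _.
  by apply: nearW => N; rewrite subr_ge0 rcdf_nondecreasing.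
have G_hi x : 1 - G x <= expR (- x) * K 1.
  have h : 1 - rcdf (X N) x @[N --> U] --> 1 - G x.
    by apply: cvgB (XG x); exact: cvg_cst.
  apply: cvgr_to_le h _.
  by apply: nearW => N; exact: rcdf_ge_tail (XK N) x.
have G_lo x : G x <= expR x * K 1.
  by apply: cvgr_to_le (XG x) _; apply: nearW => N; exact: rcdf_le_tail.
pose S x := [set G y | y in `]x, +oo[%classic].
pose F x := inf (S x).
have S0 x : S x !=set0 by exists (G (x + 1)), (x + 1) => //=; rewrite in_itv/= andbT ltrDl.
have Slb x : lbound (S x) (G x).
  by move=> z [y /=]; rewrite in_itv/= andbT => /ltW xy <-; exact: G_nd.
have FG x y : x < y -> F x <= G y.
  move=> xy; apply: ge_inf; first by exists (G x); exact: Slb.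
  by exists y => //=; rewrite in_itv/= andbT.
have GF x : G x <= F x by apply: lb_le_inf.
have F_nd : {homo F : x y / x <= y}.
  move=> x y; rewrite le_eqVlt => /predU1P[->//|xy].
  exact: le_trans (FG _ _ xy) (GF y).
have F_rc : right_continuous F.
  move=> x; apply/cvgrPdist_le => e e0.
  have [_ [y /= xy <-] ye] := inf_adherent e0 (conj (S0 x) (ex_intro _ _ (@Slb x))).
  rewrite in_itv/= andbT in xy.
  near=> z; have xz : x <= z by [].
  have zy : z < y by near: z; exact: nbhs_right_lt.
  rewrite ler0_norm ?subr_le0 ?F_nd// opprB lerBlDr addrC.
  by rewrite (le_trans (FG _ _ zy))// ltW.
have FNy0 : F @ -oo --> (0 : R).
  apply: (@squeeze_cvgr _ _ _ _ (cst 0) (fun x => expR (x + 1) * K 1)).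
  - apply: nearW => x; have /andP[G0 _] := G01 x.
    rewrite (le_trans G0 (GF x))/=.
    by apply: le_trans (FG _ (x + 1) _) (G_lo _); rewrite ltrDl.
  - exact: cvg_cst.
  - have : expR 1 * K 1 * expR x @[x --> -oo] --> expR 1 * K 1 * (0 : R).
      apply: cvgMr; apply/cvgNy_compNP; exact: cvgr_expR.
    rewrite mulr0; apply: cvg_trans; apply: near_eq_cvg; apply: nearW => x.
    by rewrite expRD; ring.
have Fy1 : F @ +oo --> (1 : R).
  apply: (@squeeze_cvgr _ _ _ _ (fun x => 1 - expR (- x) * K 1) (cst 1)).
  - apply: nearW => x; apply/andP; split.
      by have := G_hi x; have := GF x; lra.
    have /andP[_ G1] := G01 (x + 1).
    by apply: le_trans (FG _ (x + 1) _) G1; rewrite ltrDl.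
  - have : 1 - K 1 * expR (- x) @[x --> +oo] --> 1 - K 1 * (0 : R).
      by apply: cvgB; [exact: cvg_cst|apply: cvgMr; exact: cvgr_expR].
    rewrite mulr0 subr0; apply: cvg_trans; apply: near_eq_cvg; apply: nearW => x.
    by rewrite mulrC.
  - exact: cvg_cst.
have [P' [Y YF]] := exists_law_of_cdf F_nd F_rc FNy0 Fy1.
exists P', Y => x Yx.
have Fx : {for x, continuous F}.
  have := continuous_cdf_rcdf Yx; rewrite (_ : rcdf Y = F)//.
  by apply/funext => y; rewrite /rcdf YF.
suff E : G x = F x.
  rewrite YF -E (_ : (fun N => _) = EFin \o (fun N => rcdf (X N) x)); last first.
    by apply/funext => N; rewrite /= -rcdfE.
  by apply: cvg_EFin; [exact: nearW|exact: XG].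
apply/eqP; rewrite eq_le GF/=.
(* For [z < x] one has [F z <= G x]; left continuity of [F] at [x] carries this to [F x <= G x]. *)
have Fl : F z @[z --> x^'-] --> F x by apply: cvg_at_left_filter.
apply: cvgr_to_le Fl _; near=> z.
by apply: FG; near: z; exact: nbhs_left_lt.
Unshelve. all: by end_near. Qed.

End Helly.

(** * Holomorphy of the moment generating function *)

Section exp_remainders.
Context (R : realType).
Implicit Types x y : R.

Lemma normr_expR_sub1_le x : `|expR x - 1| <= `|x| * expR `|x|.
Proof.
have h1 := expR_ge1Dx x; have h2 := expR_sub1_le x.
have [x0|x0] := leP 0 x.
  by rewrite !ger0_norm//; lra.
have h3 : 1 <= expR `|x| by rewrite -[leLHS]expR0 ler_expR.
have h4 : expR x <= 1 by rewrite -[leRHS]expR0 ler_expR ltW.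
rewrite ler0_norm ?subr_le0// opprB; apply: (@le_trans _ _ `|x|).
  by rewrite ltr0_norm//; lra.
by rewrite ler_peMr.
Qed.

(** Real part of [e^z - 1 - z] at [z = x + iy], split into the real remainder and
    [e^x (1 - cos y)]. *)
Lemma exp_cos_remainder x y :
  `|expR x * cos y - 1 - x| <= (x ^+ 2 + y ^+ 2) * expR `|x|.
Proof.
rewrite (_ : _ - x = (expR x - 1 - x) - expR x * (1 - cos y)); last by ring.
apply: le_trans (ler_normB _ _) _; rewrite mulrDl lerD ?expR_Taylor1_le//.
have /andP[c0 c1] := one_sub_cos_le y.
rewrite normrM (ger0_norm c0) ger0_norm ?expR_ge0// mulrC ler_pM ?expR_ge0//.
by rewrite ler_expR ler_norm.
Qed.

(** Imaginary part of the same remainder. Of the constant 3, one unit pays for [(e^x - 1) sin y] and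
    two for [sin y - y]. *)
Lemma exp_sin_remainder x y :
  `|expR x * sin y - y| <= 3 * (x ^+ 2 + y ^+ 2) * expR `|x|.
Proof.
rewrite (_ : _ - y = (expR x - 1) * sin y + (sin y - y)); last by ring.
apply: le_trans (ler_normD _ _) _; rewrite normrM.
have h1 : `|expR x - 1| * `|sin y| <= `|x| * `|y| * expR `|x|.
  by rewrite mulrAC ler_pM// ?normr_expR_sub1_le// normr_sin_le.
have h2 := normr_sin_sub_le y.
have h3 : 1 <= expR `|x| by rewrite -[leLHS]expR0 ler_expR.
have h4 : `|x| * `|y| <= x ^+ 2 + y ^+ 2.
  rewrite -[x ^+ 2](real_normK (num_real x)) -[y ^+ 2](real_normK (num_real y)).
  by have := sqr_ge0 (`|x| - `|y|); have := normr_ge0 x; have := normr_ge0 y; nra.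
have h5 : 2 * y ^+ 2 <= 2 * (x ^+ 2 + y ^+ 2) * expR `|x|.
  have := sqr_ge0 x; have := sqr_ge0 y => y2 x2.
  apply: (@le_trans _ _ (2 * (x ^+ 2 + y ^+ 2))); first by lra.
  by rewrite ler_peMr// mulr_ge0// addr_ge0.
have h6 : `|x| * `|y| * expR `|x| <= (x ^+ 2 + y ^+ 2) * expR `|x|.
  by rewrite ler_wpM2r ?expR_ge0.
by lra.
Qed.

End exp_remainders.

Section entire_mgf.
Context (R : realType) d (T : measurableType d) (P : probability T R).
Variables (Y : {RV P >-> R}) (K : R -> R).
Hypothesis YK : exp_moments_le P Y K.

Let gc (a b y : R) := expR (a * y) * cos (b * y).
Let gs (a b y : R) := expR (a * y) * sin (b * y).

Let mcos b : measurable_fun setT (fun y : R => cos (b * y)).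
Proof.
apply: measurableT_comp; last exact: measurable_funM.
by apply: continuous_measurable_fun; exact: continuous_cos.
Qed.

Let msin b : measurable_fun setT (fun y : R => sin (b * y)).
Proof.
apply: measurableT_comp; last exact: measurable_funM.
by apply: continuous_measurable_fun; exact: continuous_sin.
Qed.

Let mexp a : measurable_fun setT (fun y : R => expR (a * y)).
Proof. by apply: measurableT_comp => //; exact: measurable_funM. Qed.

Let mgc a b : measurable_fun setT (gc a b).
Proof. exact: measurable_funM (mexp a) (mcos b). Qed.

Let mgs a b : measurable_fun setT (gs a b).
Proof. exact: measurable_funM (mexp a) (msin b). Qed.

Let expR_le_abs (a y : R) : expR (a * y) <= expR (`|a| * `|y|).
Proof. by rewrite ler_expR -normrM ler_norm. Qed.

Let gcC a b y : `|gc a b y| <= 1 * expR (`|a| * `|y|).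
Proof.
rewrite mul1r normrM (le_trans (ler_piMr _ (cos_max _)))//.
by rewrite ger0_norm ?expR_ge0.
Qed.

Let gsC a b y : `|gs a b y| <= 1 * expR (`|a| * `|y|).
Proof.
rewrite mul1r normrM (le_trans (ler_piMr _ (sin_max _)))//.
by rewrite ger0_norm ?expR_ge0.
Qed.

Let cexpE (z : R[i]) (y : R) : cexp (z * y%:C%C) =
  Complex (gc (complex.Re z) (complex.Im z) y) (gs (complex.Re z) (complex.Im z) y).
Proof. by case: z => a b; rewrite /cexp/= !mulr0 subr0 add0r. Qed.

Let dominated_mulY (g : R -> R) (C t : R) :
  measurable_fun setT g -> (forall y, `|g y| <= C * expR (t * `|y|)) ->
  P.-integrable setT (fun w => (Y w * g (Y w))%:E).
Proof.
move=> mg gC; apply: (integrable_exp_dominated YK (g := fun y => y * g y) (C := C)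
  (t := t + 1)).
  by apply: measurable_funM => //; exact: measurable_id.
have C0 : 0 <= C.
  by have := le_trans (normr_ge0 _) (gC 0); rewrite pmulr_lge0 ?expR_gt0.
move=> y; rewrite normrM (le_trans (ler_wpM2l _ (gC y)))// mulrCA ler_wpM2l//.
by have := normrX_exp_le y t 1; rewrite expr1 factS fact0 muln1 mul1r.
Qed.

(** Coordinates of [E e^(zY)] and of its derivative-to-be [E (Y e^(zY))] at [z = a + ib]. *)
Let Mc (a b : R) : R := \int[P]_w gc a b (Y w).
Let Ms (a b : R) : R := \int[P]_w gs a b (Y w).
Let Dc (a b : R) : R := \int[P]_w (Y w * gc a b (Y w)).
Let Ds (a b : R) : R := \int[P]_w (Y w * gs a b (Y w)).

(** For [s1], [s2] among [± cos (b y)], [± sin (b y)] this is a coordinate of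
    [e^(zy) (e^(hy) - 1 - hy)] with [h = u + iv]. The remainder bounds give the factor 1 + 3,
    doubled by [y^2 e^|y| <= 2 e^(2|y|)]; in the exponent, [|a| + 2] collects [z], [|u| <= 1] and
    the absorbed [y^2]. *)
Let remainder_le (s1 s2 : R -> R) (a u v : R) y :
  `|s1 y| <= 1 -> `|s2 y| <= 1 -> `|u| <= 1 ->
  `|expR (a * y) * (s1 y * (expR (u * y) * cos (v * y) - 1 - u * y) +
     s2 y * (expR (u * y) * sin (v * y) - v * y))| <=
  8 * (u ^+ 2 + v ^+ 2) * expR ((`|a| + 2) * `|y|).
Proof.
move=> s1y s2y u1.
have h1 := exp_cos_remainder (u * y) (v * y).
have h2 := exp_sin_remainder (u * y) (v * y).
have h3 : expR `|u * y| <= expR (1 * `|y|) by rewrite ler_expR normrM ler_wpM2r.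
have h4 := normrX_exp_le y 1 2; rewrite real_normK ?num_real// in h4.
have n0 : 0 <= u ^+ 2 + v ^+ 2 by rewrite addr_ge0 ?sqr_ge0.
rewrite normrM ger0_norm ?expR_ge0//.
rewrite (_ : (`|a| + 2) * `|y| = `|a| * `|y| + (1 + 1) * `|y|); last by ring.
rewrite expRD mulrCA ler_pM ?expR_ge0 ?expR_le_abs//.
apply: le_trans (ler_normD _ _) _; rewrite !normrM.
apply: (@le_trans _ _ (4 * ((u * y) ^+ 2 + (v * y) ^+ 2) * expR `|u * y|)).
  rewrite (_ : 4 * _ * _ = ((u * y) ^+ 2 + (v * y) ^+ 2) * expR `|u * y| +
    3 * ((u * y) ^+ 2 + (v * y) ^+ 2) * expR `|u * y|); last by ring.
  apply: lerD.
    by apply: le_trans h1; rewrite -[leRHS]mul1r ler_wpM2r.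
  by apply: le_trans h2; rewrite -[leRHS]mul1r ler_wpM2r.
rewrite !exprMn -mulrDl mulrA -mulrA.
rewrite (_ : 8 * (u ^+ 2 + v ^+ 2) * _ =
  4 * (u ^+ 2 + v ^+ 2) * (2 * expR ((1 + 1) * `|y|))); last by ring.
rewrite ler_wpM2l ?mulr_ge0//; apply: le_trans h4.
by rewrite ler_wpM2l ?sqr_ge0.
Qed.

Let Rintegral_remainder_le (s1 s2 : R -> R) (a u v : R) :
  measurable_fun setT s1 -> measurable_fun setT s2 ->
  (forall y, `|s1 y| <= 1) -> (forall y, `|s2 y| <= 1) -> `|u| <= 1 ->
  `|\int[P]_w (expR (a * Y w) * (s1 (Y w) * (expR (u * Y w) * cos (v * Y w) - 1 - u * Y w)
     + s2 (Y w) * (expR (u * Y w) * sin (v * Y w) - v * Y w)))| <=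
  8 * (u ^+ 2 + v ^+ 2) * K (`|a| + 2).
Proof.
move=> ms1 ms2 s11 s21 u1.
pose g y := expR (a * y) * (s1 y * (expR (u * y) * cos (v * y) - 1 - u * y) +
     s2 y * (expR (u * y) * sin (v * y) - v * y)).
have mg : measurable_fun setT g.
  have mlin c : measurable_fun setT (fun y : R => c * y) by exact: measurable_funM.
  apply: measurable_funM (mexp a) _; apply: measurable_funD.
    apply: measurable_funM ms1 _; apply: measurable_funB (mlin u).
    by apply: measurable_funB => //; exact: mgc.
  by apply: measurable_funM ms2 _; apply: measurable_funB (mlin v); exact: mgs.
apply: (normr_Rintegral_exp_dominated YK mg) => y; exact: remainder_le.
Qed.

Let lin3 (f1 f2 f3 f4 : R -> R) (u v : R) :
  P.-integrable setT (fun w => (f1 (Y w))%:E) ->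
  P.-integrable setT (fun w => (f2 (Y w))%:E) ->
  P.-integrable setT (fun w => (f3 (Y w))%:E) ->
  P.-integrable setT (fun w => (f4 (Y w))%:E) ->
  \int[P]_w (f1 (Y w) - f2 (Y w) - (u * f3 (Y w) + v * f4 (Y w))) =
  \int[P]_w f1 (Y w) - \int[P]_w f2 (Y w) -
   (u * \int[P]_w f3 (Y w) + v * \int[P]_w f4 (Y w)).
Proof.
move=> i1 i2 i3 i4.
have iu := integrable_realZl u i3; have iv := integrable_realZl v i4.
rewrite (RintegralB measurableT (integrableB measurableT i1 i2)
  (integrableD measurableT iu iv)).
by rewrite (RintegralB measurableT i1 i2) (RintegralD measurableT iu iv) !RintegralZl.
Qed.

(** The linear terms are the coordinates of [(u + iv)(Dc + i Ds)]: complex linearity in the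
    increment replaces a separate check of the Cauchy-Riemann equations. *)
Let cmgf_Taylor (a b u v : R) : `|u| <= 1 ->
  `|Mc (a + u) (b + v) - Mc a b - (u * Dc a b - v * Ds a b)| <=
     8 * (u ^+ 2 + v ^+ 2) * K (`|a| + 2) /\
  `|Ms (a + u) (b + v) - Ms a b - (u * Ds a b + v * Dc a b)| <=
     8 * (u ^+ 2 + v ^+ 2) * K (`|a| + 2).
Proof.
move=> u1.
have igc a' b' := integrable_exp_dominated YK (mgc a' b') (gcC a' b').
have igs a' b' := integrable_exp_dominated YK (mgs a' b') (gsC a' b').
have igc' a' b' := dominated_mulY (mgc a' b') (gcC a' b').
have igs' a' b' := dominated_mulY (mgs a' b') (gsC a' b').
have ncos c : measurable_fun setT (fun y : R => - sin (c * y)).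
  by apply: measurableT_comp (msin c).
split.
- rewrite -[- (v * _)]mulNr -(@lin3 (gc (a + u) (b + v)) (gc a b)
    (fun y => y * gc a b y) (fun y => y * gs a b y))//.
  rewrite (@eq_Rintegral _ _ _ P setT (fun w => expR (a * Y w) *
    (cos (b * Y w) * (expR (u * Y w) * cos (v * Y w) - 1 - u * Y w)
     + - sin (b * Y w) * (expR (u * Y w) * sin (v * Y w) - v * Y w)))) => [|w _].
    apply: (@Rintegral_remainder_le (fun y => cos (b * y)) (fun y => - sin (b * y))) => //.
      by move=> y; exact: cos_max.
    by move=> y; rewrite normrN sin_max.
  by rewrite /gc /gs !mulrDl expRD cosD; ring.
- rewrite -(@lin3 (gs (a + u) (b + v)) (gs a b)
    (fun y => y * gs a b y) (fun y => y * gc a b y))//.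
  rewrite (@eq_Rintegral _ _ _ P setT (fun w => expR (a * Y w) *
    (sin (b * Y w) * (expR (u * Y w) * cos (v * Y w) - 1 - u * Y w)
     + cos (b * Y w) * (expR (u * Y w) * sin (v * Y w) - v * Y w)))) => [|w _].
    apply: (@Rintegral_remainder_le (fun y => sin (b * y)) (fun y => cos (b * y))) => //.
      by move=> y; exact: sin_max.
    by move=> y; exact: cos_max.
  by rewrite /gc /gs !mulrDl expRD sinD; ring.
Qed.

Let cmgfE z : cmgf P Y z = Complex (Mc (complex.Re z) (complex.Im z))
  (Ms (complex.Re z) (complex.Im z)).
Proof.
rewrite /cmgf /cexpectation unlock; congr Complex; congr fine;
  by apply: eq_integral => w _; rewrite cexpE.
Qed.

Let K_ge0 t : 0 <= K t.
Proof.
apply: le_trans (Rintegral_exp_abs_le YK t).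
by apply: Rintegral_ge0 => w _; exact: expR_ge0.
Qed.

Let norm_Re_Im_le (c : R[i]) : `|c| <= (`|complex.Re c| + `|complex.Im c|)%:C%C.
Proof.
case: c => x y; rewrite normc_def lecR /=.
rewrite -[leRHS]ger0_norm ?addr_ge0// -sqrtr_sqr ler_wsqrtr//.
rewrite -(real_normK (num_real x)) -(real_normK (num_real y)) sqrrD.
by rewrite -addrA [_ *+ 2 + _]addrC addrA lerDl mulrn_wge0// mulr_ge0.
Qed.

Let norm_quotient_le (z h : R[i]) : h != 0 -> `|complex.Re h| <= 1 ->
  `|Complex (Dc (complex.Re z) (complex.Im z)) (Ds (complex.Re z) (complex.Im z)) -
    h^-1 * (cmgf P Y (h + z) - cmgf P Y z)| <=
  (16 * K (`|complex.Re z| + 2))%:C%C * `|h|.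
Proof.
move=> h0 h1; set D := Complex _ _; set F1 := cmgf _ _ _; set F0 := cmgf _ _ z.
have -> : D - h^-1 * (F1 - F0) = - (h^-1 * (F1 - F0 - h * D)) by field.
rewrite normrN normrM normfV mulrC ler_pdivrMr ?normr_gt0//.
rewrite -mulrA -expr2; apply: le_trans (norm_Re_Im_le _) _.
have -> : `|h| ^+ 2 = (complex.Re h ^+ 2 + complex.Im h ^+ 2)%:C%C.
  rewrite normc_def -rmorphXn/= sqr_sqrtr//.
  by rewrite addr_ge0 ?sqr_ge0.
rewrite -rmorphM lecR {}/F1 {}/F0 !cmgfE {}/D.
case: z => a b /= in h0 h1 *; case: h h0 h1 => u v /= _ u1.
have [T1 T2] := cmgf_Taylor a b v u1.
rewrite (addrC u) (addrC v) (_ : 16 * _ * _ = 8 * (u ^+ 2 + v ^+ 2) * K (`|a| + 2) +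
  8 * (u ^+ 2 + v ^+ 2) * K (`|a| + 2)); last by ring.
by apply: lerD.
Qed.

Theorem exp_moments_mgf_entire : mgf_entire P Y.
Proof.
split=> z.
  set a := complex.Re z; set b := complex.Im z; split.
    rewrite (_ : (fun w => _) = fun w => (gc a b (Y w))%:E).
      exact: (integrable_exp_dominated YK (mgc a b) (gcC a b)).
    by apply/funext => w; rewrite cexpE.
  rewrite (_ : (fun w => _) = fun w => (gs a b (Y w))%:E).
    exact: (integrable_exp_dominated YK (mgs a b) (gsC a b)).
  by apply/funext => w; rewrite cexpE.
apply/cvg_ex; exists (Complex (Dc (complex.Re z) (complex.Im z))
  (Ds (complex.Re z) (complex.Im z))).
apply/cvgrPdist_le => e e0; rewrite /=.
set B := 16 * K (`|complex.Re z| + 2).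
have B0 : 0 <= B by rewrite mulr_ge0.
(* The tolerance is an element of [R[i]]; positivity there forces its imaginary part to vanish. *)
have eE : e = (complex.Re e)%:C%C.
  by case: e e0 => x y; rewrite ltcE/= => /andP[/eqP -> _].
have e1 : 0 < complex.Re e by move: e0; rewrite ltcE => /andP[].
have d0 : 0 < complex.Re e / (B + 1) by rewrite divr_gt0// ltr_wpDl.
near=> h.
have h0 : h != 0 by near: h; exact: (@nbhs_dnbhs_neq _ (0 : (R[i] : numFieldType)^o)).
have h1 : `|h| < 1 by near: h; apply: (@dnbhs0_lt _ (R[i] : numFieldType)^o).
have h2 : `|h| < (complex.Re e / (B + 1))%:C%C.
  by near: h; apply: (@dnbhs0_lt _ (R[i] : numFieldType)^o); rewrite ltcR.
have Reh : `|complex.Re h| <= 1.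
  have : `|h| < (1 : R)%:C%C by [].
  rewrite normc_def ltcR => /ltW; apply: le_trans.
  by rewrite -sqrtr_sqr ler_wsqrtr// lerDl sqr_ge0.
rewrite scaler1; apply: le_trans (norm_quotient_le z h0 Reh) _.
rewrite -/B; apply: (@le_trans _ _ (B%:C%C * (complex.Re e / (B + 1))%:C%C)).
  by rewrite ler_wpM2l ?ler0c// ltW.
rewrite -rmorphM [leRHS]eE lecR mulrCA ler_piMr ?(ltW e1)//.
by rewrite ler_pdivrMr ?ltr_wpDl// mul1r lerDl.
Unshelve. all: by end_near. Qed.

End entire_mgf.

(** * The method of moments *)

Section method_of_moments.
Context (R : realType).
Context (d : nat -> measure_display) (T : forall N, measurableType (d N))
    (P : forall N, probability (T N) R) (X : forall N, {RV (P N) >-> R}).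
Variable K : R -> R.
Hypothesis XK : forall N, exp_moments_le (P N) (X N) K.

Definition cvg_law (G : set_system nat) d' (T' : measurableType d')
    (P' : probability T' R) (Y : {RV P' >-> R}) : Prop :=
  forall x : R, {for x, continuous (cdf Y)} -> cdf (X N) x @[N --> G] --> cdf Y x.

Lemma cvg_law_no_atom (G : set_system nat) {FG : Filter G}
    d' (T' : measurableType d') (P' : probability T' R) (Y : {RV P' >-> R}) :
  cvg_law G Y ->
  forall x, pmf Y x = 0 -> rcdf (X N) x @[N --> G] --> rcdf Y x.
Proof.
move=> XY x /continuous_cdf_no_atom/XY h; apply: fine_cvg.
by rewrite -rcdfE.
Qed.

Lemma eq_moments_cvg_law (G G' : set_system nat)
    {FG : ProperFilter G} {FG' : ProperFilter G'}
    d1 (T1 : measurableType d1) (P1 : probability T1 R) (Y1 : {RV P1 >-> R})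
    d2 (T2 : measurableType d2) (P2 : probability T2 R) (Y2 : {RV P2 >-> R})
    (mu : nat -> R) :
  (forall k, \int[P N]_w (X N w ^+ k) @[N --> G] --> mu k) ->
  (forall k, \int[P N]_w (X N w ^+ k) @[N --> G'] --> mu k) ->
  cvg_law G Y1 -> cvg_law G' Y2 -> cdf Y1 =1 cdf Y2.
Proof.
move=> mG mG' /cvg_law_no_atom XY1 /cvg_law_no_atom XY2.
have Y1K : exp_moments_le P1 Y1 K by exact: (exp_moments_le_limit (FG := FG) XY1 XK).
have Y2K : exp_moments_le P2 Y2 K by exact: (exp_moments_le_limit (FG := FG') XY2 XK).
suff eqm k : \int[P1]_w (Y1 w ^+ k) = \int[P2]_w (Y2 w ^+ k).
  exact: (eq_moments_cdf Y1K Y2K eqm).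
rewrite (cvg_unique (@Rhausdorff R) (cvg_Rintegral_power (FG := FG) XY1 XK (k := k)) (mG k)).
by rewrite (cvg_unique (@Rhausdorff R) (cvg_Rintegral_power (FG := FG') XY2 XK (k := k)) (mG' k)).
Qed.

(* Helly selection gives a limit law along each ultrafilter finer than [\oo];
   all of them have the moments [mu], so they coincide, and convergence along
   all these ultrafilters is convergence. *)
Lemma cvg_law_of_cvg_moments (mu : nat -> R) :
  (forall k, \int[P N]_w (X N w ^+ k) @[N --> \oo] --> mu k) ->
  exists (P' : probability (measurableTypeR R) R) (Y : {RV P' >-> R}),
    cvg_law \oo Y.
Proof.
move=> mX; have [U0 [UU0 ooU0]] := @ultraFilterLemma nat \oo _.
have [P' [Y XY]] := Helly_selection XK UU0; exists P', Y => x Yx V Vx.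
apply: contrapT => nV; pose D := [set N | ~ V (cdf (X N) x)].
(* If the neighbourhood [V] is not eventually reached, the bad indices [D] occur infinitely often,
   and some ultrafilter finer than [\oo] contains [D]. *)
have FD : ProperFilter (within D \oo).
  apply: Build_ProperFilter_ex => A; rewrite /within/= => DA.
  apply: contrapT => nA; apply: nV; apply: filterS DA => N DN.
  by apply: contrapT => VN; apply: nA; exists N; exact: DN.
have [U [UU DU]] := ultraFilterLemma FD.
have ooU : \oo `<=` U by move=> A ooA; apply: DU; apply: filterS ooA => N AN _.
have [P1 [Y1 XY1]] := Helly_selection XK UU.
have E : cdf Y1 =1 cdf Y.
  apply: (@eq_moments_cvg_law U U0 _ _ _ _ _ _ _ _ _ _ mu) => // k A /mX; [exact: ooU|exact: ooU0].
have Y1x : {for x, continuous (cdf Y1)} by rewrite (_ : cdf Y1 = cdf Y)//; exact/funext.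
have UV : U [set N | V (cdf (X N) x)] by apply: (XY1 x Y1x V); rewrite E.
have UD : U D by apply: DU; rewrite /within/=; exact: filterE.
have UVD : U ([set N | V (cdf (X N) x)] `&` D) by exact: filterI.
have [N [VN DN]] : exists N, ([set N | V (cdf (X N) x)] `&` D) N.
  exact: (@filter_ex _ U).
exact: DN VN.
Qed.

Lemma moment_Rintegral d0 (T0 : measurableType d0) (P0 : probability T0 R)
    (Y : {RV P0 >-> R}) (K0 : R -> R) k : exp_moments_le P0 Y K0 ->
  moment P0 Y k = (\int[P0]_w (Y w ^+ k))%:E.
Proof.
move=> YK; rewrite /moment unlock /Rintegral fineK//.
exact: integrable_fin_num (integrable_power YK k).
Qed.

(** A competitor [Y'] is known through its moments only; its exponential bound is first recovered
    from them. *)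
Lemma exp_moments_determined d0 (T0 : measurableType d0) (P0 : probability T0 R)
    (Y : {RV P0 >-> R}) (K0 : R -> R) :
  exp_moments_le P0 Y K0 -> determined_by_moments Y.
Proof.
move=> YK; split=> [k|d' T' P' Y' Y'Y]; first exact: integrable_power YK k.
have eqm k : \int[P0]_w (Y w ^+ k) = \int[P']_w (Y' w ^+ k).
  have [_] := Y'Y k; rewrite (moment_Rintegral k YK) /moment unlock.
  by rewrite /Rintegral => ->.
have Y'K := exp_moments_le_eq_moments YK (fun k => (Y'Y k).1) eqm.
by apply: eq_cdf_distribution => x; rewrite (eq_moments_cdf YK Y'K eqm).
Qed.

End method_of_moments.

Theorem theorem1p8 (R : realType)
    (d : nat -> measure_display) (T : forall N, measurableType (d N))
    (P : forall N, probability (T N) R) (X : forall N, {RV (P N) >-> R})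
    (f : nat -> {poly int})
    (f_CGF : forall N, is_CGF R (f N))
    (X_f : forall N, corresponds_to (X N) (f N))
    (X_var : forall N, (0 < 'V_(P N)[X N])%E) :
  (is_cvg_in_distribution (fun N => standardize (X N)) <->
   forall k : nat, (1 <= k)%N ->
     exists mu_k : R,
       moment (P N) (standardize (X N)) k @[N --> \oo] --> mu_k%:E)
  /\
  (forall (d' : measure_display) (T' : measurableType d')
      (P' : probability T' R) (Y : {RV P' >-> R}),
     cvg_in_distribution (fun N => standardize (X N)) Y ->
     [/\ forall k : nat, (1 <= k)%N ->
           finite_moment P' Y k /\
           moment (P N) (standardize (X N)) k @[N --> \oo] --> moment P' Y k,
         determined_by_moments Y &
         mgf_entire P' Y]).
Proof.
have XK N := exp_moments_standardize (f_CGF N) (X_f N) (X_var N).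
have main (d' : measure_display) (T' : measurableType d') (P' : probability T' R)
    (Y : {RV P' >-> R}) : cvg_in_distribution (fun N => standardize (X N)) Y ->
  [/\ forall k : nat, (1 <= k)%N ->
           finite_moment P' Y k /\
           moment (P N) (standardize (X N)) k @[N --> \oo] --> moment P' Y k,
         determined_by_moments Y &
         mgf_entire P' Y].
  move=> /cvg_law_no_atom XY.
  have YK : exp_moments_le P' Y (fun t => 2 * expR (t ^+ 2 * expR (2 * `|t|))) by exact: (exp_moments_le_limit (FG := eventually_filter) XY XK).
  split; [move=> k _|exact: exp_moments_determined YK|exact: exp_moments_mgf_entire YK].
  split; first exact: integrable_power YK k.
  rewrite (moment_Rintegral k YK).
  rewrite (_ : (fun N => _) = EFin \o (fun N => \int[P N]_w (standardize (X N) w ^+ k))).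
    apply: cvg_EFin; [exact: nearW|exact: (cvg_Rintegral_power (FG := eventually_filter) XY XK (k := k))].
  by apply/funext => N; rewrite /= (moment_Rintegral k (XK N)).
split; last exact: main.
split=> [[d' [T' [P' [Y XY]]]] k k1|mom].
  have [/(_ k k1)[ik cvgk] _ _] := main _ _ _ _ XY.
  exists (fine (moment P' Y k)); rewrite fineK//.
  by rewrite /moment unlock; exact: integrable_fin_num ik.
have /choice[mu muP] : forall k, exists m : R,
    \int[P N]_w (standardize (X N) w ^+ k) @[N --> \oo] --> m.
  move=> [|k].
    (* The assumption starts at [k = 1]; the zeroth moment is constantly 1. *)
    exists 1; rewrite (_ : (fun N => _) = cst 1); first exact: cvg_cst.
    apply/funext => N; under eq_Rintegral do rewrite expr0.
    by rewrite Rintegral_cst//; have /(congr1 fine)/= -> := probability_setT (P N);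
      rewrite mulr1.
  have [m mP] := mom k.+1 (ltn0Sn k); exists m; apply: fine_cvg.
  rewrite (_ : (fun N => _) = fun N => moment (P N) (standardize (X N)) k.+1)//.
  by apply/funext => N; rewrite /moment unlock.
have [P' [Y XY]] := cvg_law_of_cvg_moments XK muP.
by exists _, _, P', Y.
Qed.
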